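(* The outcome of the Maker-Breaker domination game on a tree (given as a starting position) can be decided in polynomial time.
   Context: The Maker-Breaker domination game on a graph: Dominator and Staller alternately choose a not-yet-chosen vertex (no passing), starting with all vertices unchosen; when all vertices are chosen, Dominator wins if his vertices form a dominating set of the graph, otherwise Staller wins. The outcome is $\mathcal D$ if Dominator has a winning strategy both as first and as second player, $\mathcal S$ if Staller has a winning strategy both as first and as second player, and $\mathcal N$ if the first player has a winning strategy; every graph has one of these three outcomes. *)

(* Defs.v *)
From mathcomp Require Import all_boot all_order.
Set Implicit Arguments. Unset Strict Implicit. Unset Printing Implicit Defensive.

Definition simple_graph (T : finType) (e : rel T) : Prop :=
  irreflexive e /\ symmetric e.

Definition is_tree (T : finType) (e : rel T) : Prop :=
  [/\ simple_graph e, 0 < #|T|,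
      (forall x y : T, connect e x y) &
      (forall s : seq T, uniq s -> 3 <= size s -> ~~ cycle e s)].

Definition dominating (T : finType) (e : rel T) (D : {set T}) : bool :=
  [forall v, (v \in D) || [exists u, (u \in D) && e u v]].

(* dom_wins e k D S dturn : Dominator wins (has a winning strategy) from the
   position where Dominator has chosen D, Staller has chosen S, there are k
   unchosen vertices, and it is Dominator's turn iff dturn.  This is the
   standard game-tree (backward induction) evaluation of the finite
   perfect-information game; no passing is allowed. *)
Fixpoint dom_wins (T : finType) (e : rel T) (k : nat) (D S : {set T})
    (dturn : bool) : bool :=
  match k with
  | 0 => dominating e D
  | k'.+1 =>
      if dturn then
        [exists v, (v \notin D :|: S) && dom_wins e k' (v |: D) S false]
      else
        [forall v, (v \notin D :|: S) ==> dom_wins e k' D (v |: S) true]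
  end.

Definition dom_wins_game (T : finType) (e : rel T) (dfirst : bool) : bool :=
  dom_wins e #|T| set0 set0 dfirst.

Inductive outcome := Out_D | Out_S | Out_N | Out_other.

(* The outcome of the game: D if Dominator wins both as first and second
   player, S if Staller wins both as first and second player, N if the first
   player wins; Out_other would be "second player wins", which the paper notes
   never happens. *)
Definition game_outcome (T : finType) (e : rel T) : outcome :=
  match dom_wins_game e true, dom_wins_game e false with
  | true, true => Out_D
  | false, false => Out_S
  | true, false => Out_N
  | false, true => Out_other
  end.

Definition outcome_code (o : outcome) : nat :=
  match o with Out_D => 0 | Out_S => 1 | Out_N => 2 | Out_other => 3 end.

Definition graph_of (n : nat) (es : seq (nat * nat)) : rel 'I_n :=
  fun x y => ((val x, val y) \in es) || ((val y, val x) \in es).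
Arguments graph_of : clear implicits.

Definition valid_edges (n : nat) (es : seq (nat * nat)) : bool :=
  all (fun p => [&& p.1 < n, p.2 < n & p.1 != p.2]) es.

(* Model of computation: unit-cost RAM with additive arithmetic             *)
(* (addition, truncated subtraction), constants, indirect addressing and    *)
(* conditional jumps.  This model is polynomially equivalent to Turing      *)
(* machines (no unit-cost multiplication).                                  *)

Inductive instr :=
  | IConst of nat & nat
  | IAdd of nat & nat & nat
  | ISub of nat & nat & nat
  | ILoad of nat & nat
  | IStore of nat & nat
  | IJz of nat & nat
  | IJmp of nat
  | IHalt.

Definition ram_mem := nat -> nat.

Definition upd (m : ram_mem) (r v : nat) : ram_mem := fun i => if i == r then v else m i.

(* One step; None when the machine has halted (Halt or pc out of program). *)
Definition step (P : seq instr) (st : nat * ram_mem) : option (nat * ram_mem) :=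
  let: (pc, m) := st in
  match nth IHalt P pc with
  | IConst r c => Some (pc.+1, upd m r c)
  | IAdd r a b => Some (pc.+1, upd m r (m a + m b))
  | ISub r a b => Some (pc.+1, upd m r (m a - m b))
  | ILoad r a => Some (pc.+1, upd m r (m (m a)))
  | IStore a b => Some (pc.+1, upd m (m a) (m b))
  | IJz a l => Some (if m a == 0 then l else pc.+1, m)
  | IJmp l => Some (l, m)
  | IHalt => None
  end.

Fixpoint run (fuel : nat) (P : seq instr) (st : nat * ram_mem) : option ram_mem :=
  match step P st with
  | None => Some st.2
  | Some st' => if fuel is f.+1 then run f P st' else None
  end.

(* Initial memory: R[0] = n, R[1] = number of edges, and the i-th edge (u,v)
   is stored in R[2+2i], R[3+2i]; all other registers are 0. *)
Definition init_mem (n : nat) (es : seq (nat * nat)) : ram_mem :=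
  fun i =>
    if i == 0 then n
    else if i == 1 then size es
    else let j := i - 2 in
         let p := nth (0, 0) es j./2 in
         if odd j then p.2 else p.1.

(* Main.v *)
Require Import Defs.
From mathcomp Require Import all_boot all_order zify.
Set Implicit Arguments. Unset Strict Implicit. Unset Printing Implicit Defensive.
Local Arguments upd : simpl never.

(* Let Q be the vertices already dominated by Dominator's first move x, if any.
   If u is an unplayed vertex outside Q with a single unplayed neighbour v and
   Staller is to move, then u and v can be deleted: Dominator may pair them, and
   Staller may play v, which forces Dominator to answer u.  In a tree, some vertex
   outside Q left has at most one neighbour left, for instance the end of a longest
   path from x; so deletion stops either inside Q, and Dominator wins by pairing,
   or at an isolated vertex outside Q, which Staller takes.  Running this greedy
   deletion for no first move and for each first move x decides the outcome. *)

(** * The game on trees *)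

Section Game.
Variables (T : finType) (e : rel T).
Implicit Types (A B D S Q : {set T}).

(** The order of deletions does not matter: each of the two forms of a terminal set gives one side a
    winning strategy, so the program may delete the first redex it meets. Acyclicity serves to show
    that there are no other terminal sets. This is why [Q] has to be empty or the neighbourhood of
    one deleted vertex [x]: a step from the end of a longest path into [Q] then closes a cycle
    through [x]. The time bound concerns a concrete machine whose input fills the memory from
    register 0 on, up to an extent known only from register 1, so working registers have to be freed
    before the algorithm can start. The algorithm itself is written in a small loop language whose
    loop limits are read-only; a polynomial running time then follows from the syntax, and a single
    simulation proof transfers it to the machine. *)

Definition dominated D v := (v \in D) || [exists u, (u \in D) && e u v].

Lemma dominatedP D v :
  reflect (v \in D \/ exists2 u, u \in D & e u v) (dominated D v).
Proof.
apply: (iffP orP) => -[H|H]; try by left.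
- by right; case/existsP: H => u /andP[]; exists u.
- by right; apply/existsP; case: H => u Du uv; exists u; rewrite Du.
Qed.

Lemma dominated_sub D D' v : D \subset D' -> dominated D v -> dominated D' v.
Proof.
move=> /subsetP sD /dominatedP[/sD H|[u /sD Du uv]]; apply/dominatedP; first by left.
by right; exists u.
Qed.

Lemma card_free_D D S v k :
  v \notin D :|: S -> #|~: (D :|: S)| = k.+1 -> #|~: (v |: D :|: S)| = k.
Proof.
move=> vf; rewrite (cardsD1 v) inE vf add1n => -[<-].
by apply: eq_card => z; rewrite !inE; case: eqP.
Qed.

Lemma card_free_S D S v k :
  v \notin D :|: S -> #|~: (D :|: S)| = k.+1 -> #|~: (D :|: (v |: S))| = k.
Proof.
move=> vf; rewrite (cardsD1 v) inE vf add1n => -[<-].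
by apply: eq_card => z; rewrite !inE orbCA; case: eqP.
Qed.

(** Paired vertices are adjacent, so once Dominator owns one of them both are dominated; his answer
    restores the invariant after each move of Staller. The induction removes two moves at a time.
    With one free vertex left no pair can be free, so everything is already dominated. *)
Lemma pairing_wins (f : T -> T) k D S :
    involutive f -> symmetric e ->
    (forall v, dominated D v \/
       [/\ f v != v, e v (f v), v \notin D :|: S & f v \notin D :|: S]) ->
    #|~: (D :|: S)| = k ->
  dom_wins e k D S false.
Proof.
move=> fK sym; elim/ltn_ind: k D S => -[|[|k]] IH D S inv card.
- apply/forallP => v; case: (inv v) => // -[_ _ vf _].
  by move/eqP: card; rewrite cards_eq0 => /eqP/setP/(_ v); rewrite inE vf inE.
- apply/forallP => s; apply/implyP => sf; apply/forallP => v.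
  case: (inv v) => // -[fv _ vf fvf].
  have /eqP/cards1P[z /setP zE] := card.
  have := zE v; rewrite in_setC vf in_set1 => /esym/eqP vz.
  have := zE (f v); rewrite in_setC fvf in_set1 => /esym/eqP fvz.
  by rewrite fvz vz eqxx in fv.
apply/forallP => s; apply/implyP => sf.
have card1 := card_free_S sf card.
suff [d df inv']: exists2 d, d \notin D :|: (s |: S) & forall v, dominated (d |: D) v \/
    [/\ f v != v, e v (f v), v \notin d |: D :|: (s |: S)
      & f v \notin d |: D :|: (s |: S)].
  apply/existsP; exists d; rewrite df /=.
  by apply: IH => //; apply: card_free_D.
(* d answers s by its partner; another free vertex d is a harmless extra move. *)
suff [d df ds]: exists2 d, d \notin D :|: (s |: S) &
    forall v, [/\ f v != v, e v (f v), v \notin D :|: S & f v \notin D :|: S] ->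
       v = s \/ f v = s -> d = f s.
  exists d => // v; case: (inv v) => [dv|Hv].
    by left; apply: dominated_sub dv; apply: subsetUr.
  have [fv ev vf fvf] := Hv.
  have [vd|vd] := eqVneq v d; first by left; apply/dominatedP; left; rewrite vd setU11.
  have [fvd|fvd] := eqVneq (f v) d.
    by left; apply/dominatedP; right; exists d; rewrite ?setU11 // sym -fvd.
  have vs : v != s.
    by apply: contra_neq fvd => vs'; rewrite (ds v Hv (or_introl vs')) vs'.
  have fvs : f v != s.
    by apply: contra_neq vd => vs'; rewrite (ds v Hv (or_intror vs')) -vs' fK.
  right; move: vf fvf; rewrite !inE !negb_or => /andP[-> ->] /andP[-> ->].
  by rewrite vs fvs vd fvd ev fv.
have [/andP[fs fsf]|nfs] := boolP ((f s != s) && (f s \notin D :|: S)).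
  by exists (f s) => //; move: fsf; rewrite !inE !negb_or fs.
have /card_gt0P[d df] : 0 < #|~: (D :|: (s |: S))| by rewrite card1.
exists d; first by rewrite inE in df.
move=> v [fv ev vf fvf] [vs|vs]; case/negP: nfs; rewrite -vs ?fK ?fv ?fvf //.
by rewrite eq_sym fv vf.
Qed.

(** Later moves of Dominator avoid [w] and all its neighbours, so [w] stays undominated to the end,
    whoever is to move. *)
Lemma enclosed_loses w k D S b :
    ~~ dominated D w -> w \in S -> (forall z, e z w -> z \in S) ->
    #|~: (D :|: S)| = k ->
  dom_wins e k D S b = false.
Proof.
elim: k D S b => [|k IH] D S b ndw wS zS card /=.
  by apply/negbTE/forallPn; exists w.
case: b.
  apply/negbTE/existsPn => v; rewrite negb_and negbK.
  have [//|vf /=] := boolP (v \in D :|: S).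
  rewrite IH ?(card_free_D vf card) //; apply: contra ndw => /dominatedP[|[u]]; rewrite !inE.
    case/orP=> [/eqP wv|wD]; first by move: vf; rewrite -wv inE wS orbT.
    by apply/dominatedP; left.
  case/orP=> [/eqP-> /zS vS|uD uw]; first by move: vf; rewrite inE vS orbT.
  by apply/dominatedP; right; exists u.
(* Staller needs an actual move here: with no free vertex the universal quantifier in [dom_wins]
   would hold vacuously. Hence the exact count [card]. *)
have /card_gt0P[v] : 0 < #|~: (D :|: S)| by rewrite card.
rewrite inE => vf; apply/negbTE/forallPn; exists v; rewrite vf /= IH //.
- by rewrite inE wS orbT.
- by move=> z /zS zS'; rewrite inE zS' orbT.
- exact: card_free_S vf card.
Qed.

(** * Deletion of forced pairs and the terminal sets it reaches *)

Variable Q : {set T}.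

(* Q is the set of vertices of A that need not be dominated any more; u is a
   vertex that must be dominated, whose only partner left in A is v. *)
Definition redex A u v :=
  [&& u \in A, u \notin Q, v \in A, e u v & [forall w in A, e u w ==> (w == v)]].

Inductive reduces A : {set T} -> Prop :=
  | reduces_refl : reduces A A
  | reduces_step u v B : redex A u v -> reduces (A :\ u :\ v) B -> reduces A B.

Lemma reduces_sub A B : reduces A B -> B \subset A.
Proof.
elim=> [//|{}A u v {}B _ _ sB]; apply: subset_trans sB _.
by apply: subset_trans (subsetDl _ _) (subsetDl _ _).
Qed.

Lemma reduces_rcons A B u v : reduces A B -> redex B u v -> reduces A (B :\ u :\ v).
Proof.
elim=> [{}A r|{}A u' v' {}B r _ IH /IH]; last exact: reduces_step.
by apply: reduces_step r _; apply: reduces_refl.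
Qed.

Lemma reduces_trans A B C : reduces A B -> reduces B C -> reduces A C.
Proof. by elim=> [//|{}A u v {}B r _ IH /IH]; apply: reduces_step. Qed.

Definition irreducible A := forall u v, ~~ redex A u v.

Lemma irreducible_eq A B : irreducible A -> reduces A B -> B = A.
Proof. by move=> irrA [//|u v C r]; have := irrA u v; rewrite r. Qed.

(** A matching inside [A] that covers [A] minus [Q], encoded as an involution whose fixed points are
    the unmatched vertices. *)
Definition matched A := exists f : T -> T,
  [/\ involutive f, forall v, f v != v -> v \in A /\ e v (f v)
    & forall v, v \in A -> v \notin Q -> f v != v].

(** The deleted pairs are disjoint edges. The involution obtained for the remaining vertices fixes
    [u] and [v], so exchanging these two extends it. *)
Lemma reduces_matched A B : symmetric e -> irreflexive e ->
  reduces A B -> B \subset Q -> matched A.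
Proof.
move=> sym irr; elim=> {A B} [A|A u v B r _ IH] sBQ.
  by exists id; split=> // v => [|/(subsetP sBQ)->//]; rewrite eqxx.
have [f [fK fA fQ]] := IH sBQ; case/and5P: r => uA uQ vA uv _.
have uv' : u != v by apply: contraTneq uv => ->; rewrite irr.
have vu' : v != u by rewrite eq_sym.
have fu : f u = u by apply: contraTeq isT => /fA[]; rewrite !inE eqxx andbF.
have fv : f v = v by apply: contraTeq isT => /fA[]; rewrite !inE eqxx.
exists (fun z => if z == u then v else if z == v then u else f z); split.
- move=> z; case: (eqVneq z u) => [->|zu]; first by rewrite (negbTE vu') eqxx.
  case: (eqVneq z v) => [->|zv]; first by rewrite eqxx.
  by rewrite -{1}fu -{2}fv !(inj_eq (inv_inj fK)) (negbTE zu) (negbTE zv) fK.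
- move=> z; case: (eqVneq z u) => [->//|zu]; case: (eqVneq z v) => [->|zv].
    by rewrite sym.
  by case/fA; rewrite !inE => /and3P[].
move=> z zA zQ; case: (eqVneq z u) => [->//|zu]; case: (eqVneq z v) => [->//|zv].
by apply: fQ; rewrite // !inE zu zv.
Qed.

Lemma card_free A D S : D :|: S = ~: A -> #|~: (D :|: S)| = #|A|.
Proof. by move->; rewrite setCK. Qed.

(* Playing v, Staller threatens to enclose u, so that Dominator must take u,
   which is of no use for the vertices left. *)
Lemma reduces_loses A B w : symmetric e -> irreflexive e ->
    reduces A B -> w \in B -> w \notin Q -> (forall z, z \in B -> ~~ e w z) ->
  forall D S, D :|: S = ~: A -> {in A, forall z, dominated D z = (z \in Q)} ->
  dom_wins e #|A| D S false = false.
Proof.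
move=> sym irr; elim=> {A B} [A|A u v B r _ IH] wB wQ iso D S DS domQ.
  have wDS : w \notin D :|: S by rewrite DS inE wB.
  have := card_free DS; case: #|A| (@card0_eq _ (mem A)) => [/(_ erefl w)|k _ card /=].
    by rewrite wB.
  apply/negbTE/forallPn; exists w; rewrite wDS /=.
  have nw : ~~ dominated D w by rewrite domQ.
  rewrite (@enclosed_loses w) ?setU11 ?(card_free_S wDS card) // => z zw.
  have : z \in D :|: S by rewrite DS inE; apply: contraL zw => /iso; rewrite sym.
  rewrite !inE => /orP[zD|->]; last by rewrite orbT.
  by case/dominatedP: nw; right; exists z.
case/and5P: r => uA uQ vA uv /forall_inP onlyv.
have uv' : u != v by apply: contraTneq uv => ->; rewrite irr.
have nu : ~~ dominated D u by rewrite domQ.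
have vDS : v \notin D :|: S by rewrite DS inE vA.
have cardA : #|A| = #|A :\ u :\ v|.+2.
  by rewrite (cardsD1 u) uA (cardsD1 v) !inE eq_sym uv' vA.
have card := card_free DS; rewrite cardA in card *.
apply/negbTE/forallPn; exists v; rewrite vDS /=.
apply/existsPn => y; rewrite negb_and negbK.
rewrite -/(dom_wins e #|A :\ u :\ v| (y |: D) (v |: S) false).
have [//|yf] := boolP (y \in D :|: (v |: S)); rewrite orFb.
have card1 := card_free_D yf (card_free_S vDS card).
have [yu|yu] := eqVneq y u.
  rewrite yu IH //.
    apply/setP => z; have /setP/(_ z) := DS.
    by rewrite !inE; case: (z == u); case: (z == v); rewrite //= ?orbT // orbF.
  move=> z; rewrite !inE => /and3P[zv zu zA]; rewrite -domQ //.
  apply/idP/idP; last by apply: dominated_sub; apply: subsetUr.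
  case/dominatedP => [|[t]]; rewrite !inE.
    by rewrite (negbTE zu) /= => zD; apply/dominatedP; left.
  case/orP=> [/eqP->|tD] tz; last by apply/dominatedP; right; exists t.
  by have := onlyv z zA; rewrite tz (negbTE zv).
have uf : u \notin y |: D :|: (v |: S).
  have : u \notin D :|: S by rewrite DS inE uA.
  by rewrite !inE eq_sym (negbTE yu) (negbTE uv').
(* The game is not over after [v] and [y], because [u] is still free. *)
case: #|A :\ u :\ v| card1 => [|k] card1.
  by move/eqP: card1; rewrite cards_eq0 => /eqP/setP/(_ u); rewrite inE uf inE.
apply/forallPn; exists u; rewrite uf implyTb.
rewrite -/(dom_wins e k (y |: D) (u |: (v |: S)) true) (@enclosed_loses u) ?setU11 ?(card_free_S uf card1) //.
  apply: contra nu => /dominatedP[|[t]]; rewrite !inE.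
    by rewrite eq_sym (negbTE yu) /= => uD; apply/dominatedP; left.
  case/orP=> [/eqP->|tD tu]; last by apply/dominatedP; right; exists t.
  rewrite sym => uy; have /onlyv : y \in A.
    by have := yf; rewrite setUCA DS !inE !negb_or negbK => /andP[].
  by rewrite uy => /eqP yv; move: yf; rewrite yv !inE eqxx orbT.
move=> z zu; have [zA|zA] := boolP (z \in A).
  by have := onlyv z zA; rewrite sym zu => /eqP->; rewrite !inE eqxx orbT.
have : z \in D :|: S by rewrite DS inE.
rewrite !inE => /orP[zD|->]; last by rewrite !orbT.
by case/dominatedP: nu; right; exists z.
Qed.

Lemma irreducible_isolated A : is_tree e -> irreducible A -> ~~ (A \subset Q) ->
    Q = set0 \/ (exists2 x, x \notin A & Q = [set z | e x z]) ->
  exists w, [/\ w \in A, w \notin Q & forall z, z \in A -> ~~ e w z].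
Proof.
case=> -[irr sym] _ conn acyc irrA /subsetPn[a aA aQ] HQ.
(* The path starts at the first move [x]; if [Q] is empty the condition is vacuous and [a] serves as
   the root. *)
have [r rP] : exists r, forall z, z \in Q -> r \notin A /\ e r z.
  case: HQ => [->|[x xA ->]]; first by exists a => z; rewrite inE.
  by exists x => z; rewrite inE.
(* The path may run through deleted vertices; only its end must lie in [A] outside [Q]. *)
pose ok k := [exists p : k.-tuple T,
  [&& path e r p, uniq (r :: p) & last r p \in A :\: Q]].
have exk : exists k, ok k.
  case/connectP: (conn r a) => p0; case/shortenP=> p ep up _ lp.
  by exists (size p); apply/existsP; exists (in_tuple p); rewrite ep up -lp inE aA aQ.
have bnd k : ok k -> k <= #|T|.
  case/existsP => p /and3P[_ /card_uniqP /= up _].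
  by rewrite ltnW // -{1}(size_tuple p) -up max_card.
have [k /existsP[[p /= /eqP sz] /and3P[ep up lp]] kmax] := ex_maxnP exk bnd.
move: (lp); rewrite inE => /andP[uQ uA]; set u := last r p in lp uQ uA.
(* Walking on from the end of a longest path to a required vertex would either
   lengthen it or close a cycle, so its only neighbour in A precedes it. *)
have inp z : z \in A -> e u z -> z \in r :: p.
  move=> zA uz; apply/negPn/negP => zp.
  have epz : path e r (rcons p z) by rewrite rcons_path ep.
  have upz : uniq (r :: rcons p z) by rewrite -rcons_cons rcons_uniq zp.
  suff : ok k.+1 by move/kmax; rewrite ltnn.
  have szz : size (rcons p z) == k.+1 by rewrite size_rcons sz.
  apply/existsP; exists (Tuple szz); rewrite last_rcons epz upz inE zA andbT.
  apply/negP => /rP[rA rz].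
  (* A cycle needs three vertices: [r], [u] and [z] are distinct because [u] is in [A] and [r] is
     not. *)
  have p0 : p != [::] by apply: contraNneq rA => p0; move: uA; rewrite /u p0.
  have := acyc _ upz; rewrite /= rcons_path epz last_rcons sym rz size_rcons.
  by case: (p) p0 => // b l _ /(_ isT).
have [q uq] : exists q, forall z, z \in A -> e u z -> z = q.
  case/lastP: p @u {sz lp} ep up uQ uA inp => [|p u0] u ep up uQ uA inp.
    by exists r => z /inp H /H; rewrite inE => /eqP.
  rewrite /u last_rcons in uQ uA inp *; exists (last r p) => z zA uz.
  have := inp z zA uz; rewrite -rcons_cons mem_rcons inE.
  case: (eqVneq z u0) uz => [->|zu uz /= zp]; first by rewrite irr.
  case/splitPl: zp ep up {inp u} => p1 p2 lz; rewrite last_cat lz.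
  case: p2 => [//|b p2]; rewrite rcons_cat cat_path lz => /andP[_ ep2] up.
  have {}up : uniq (z :: rcons (b :: p2) u0).
    by move: up; rewrite -cons_uniq -cat_cons lastI cat_rcons lz cat_uniq => /and3P[].
  have cyc : cycle e (z :: rcons (b :: p2) u0).
    by rewrite /cycle rcons_path ep2 last_rcons uz.
  by have := acyc _ up; rewrite cyc /= size_rcons => /(_ isT).
exists u; split=> // z zA; apply/negP => uz.
case/negP: (irrA u z); rewrite /redex uA uQ zA uz /=.
by apply/forall_inP => w wA; apply/implyP => uw; rewrite (uq z zA uz) (uq w wA uw).
Qed.

(** Both directions are strategies read off the same reduction: if [B] lies in [Q], the deleted
    pairs are Dominator's pairing; otherwise [B] has an isolated vertex outside [Q], which Staller
    reaches by forcing the deleted pairs one by one. *)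
Lemma reduced_dom_wins A B D S : is_tree e -> reduces A B -> irreducible B ->
    D :|: S = ~: A ->
    {in A, forall z, dominated D z = (z \in Q)} ->
    {in ~: A, forall z, dominated D z} ->
    Q = set0 \/ (exists2 x, x \notin A & Q = [set z | e x z]) ->
  dom_wins e #|A| D S false = (B \subset Q).
Proof.
move=> tree red irrB DS domQ domC HQ.
have [[irr sym] _ _ _] := tree.
have [sBQ|nBQ] := boolP (B \subset Q).
  have [f [fK fA fQ]] := reduces_matched sym irr red sBQ.
  apply: (pairing_wins fK) => // [v|]; last exact: card_free.
  have [vA|vA] := boolP (v \in A); last by left; apply: domC; rewrite inE.
  have [vQ|vQ] := boolP (v \in Q); first by left; rewrite domQ.
  right; have fv := fQ v vA vQ; have [_ ev] := fA v fv.
  have [fvA _] : f v \in A /\ e (f v) (f (f v)) by apply: fA; rewrite fK eq_sym.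
  by rewrite DS !inE vA fvA.
have HQB : Q = set0 \/ (exists2 x, x \notin B & Q = [set z | e x z]).
  case: HQ => [|[x xA]]; [by left|right; exists x => //].
  by apply: contra xA; apply: (subsetP (reduces_sub red)).
have [w [wB wQ iso]] := irreducible_isolated tree irrB nBQ HQB.
exact: (reduces_loses sym irr red wB wQ iso).
Qed.

Lemma reduces_irreducible A : exists B, reduces A B /\ irreducible B.
Proof.
have [k] := ubnP #|A|; elim: k A => // k IH A; rewrite ltnS => cA.
have [/existsP[u /existsP[v r]]|/existsPn H] := boolP [exists u, exists v, redex A u v].
  have [|B [rB irrB]] := IH (A :\ u :\ v).
    apply: leq_trans cA; apply: proper_card; apply: sub_proper_trans (subsetDl _ _) _.
    by apply: properD1; case/and5P: r.
  by exists B; split=> //; apply: reduces_step rB.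
by exists A; split; [exact: reduces_refl|move=> u v; have /existsPn := H u].
Qed.
End Game.

(** Winning as second player forces the reduction to exhaust the tree, which gives a perfect
    matching. An extra move [x] dominates [x] and its partner and leaves all other pairs free, so
    pairing still wins. This rules out [Out_other]. *)
Lemma dom_wins_second_first (T : finType) (e : rel T) x : is_tree e ->
  dom_wins e #|T| set0 set0 false -> dom_wins e #|T|.-1 [set x] set0 false.
Proof.
move=> tree; have [[irr sym] _ _ _] := tree.
have [B [rB irrB]] := reduces_irreducible e set0 setT.
rewrite -cardsT (reduced_dom_wins tree rB irrB) ?setU0 ?setCT //; last by left.
- move=> sB; have [f [fK fA fQ]] := reduces_matched sym irr rB sB.
  apply: (pairing_wins fK) => // [v|]; last by rewrite setU0 cardsT cardsC1.
  have fv : f v != v by apply: fQ; rewrite inE.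
  have [_ ev] := fA v fv; rewrite setU0 !inE.
  have [->|vx] := eqVneq v x; first by left; apply/dominatedP; left; rewrite inE.
  have [fvx|fvx] := eqVneq (f v) x; last by right.
  by left; apply/dominatedP; right; exists x; rewrite ?inE // sym -fvx.
- move=> z _; rewrite inE; apply/negbTE/dominatedP => -[|[u]]; by rewrite inE.
- by move=> z; rewrite inE.
Qed.

(** * Executions of RAM programs *)

Lemma upd_same m r x : upd m r x r = x.
Proof. by rewrite /upd eqxx. Qed.

Lemma upd_other m r x i : i != r -> upd m r x i = m i.
Proof. by rewrite /upd => /negbTE->. Qed.

Fixpoint nsteps k P st :=
  if k is k'.+1 then (if step P st is Some st' then nsteps k' P st' else None)
  else Some st.

Definition reaches P N st st' := exists2 k, k <= N & nsteps k P st = Some st'.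

Lemma nstepsD k l P st st' : nsteps k P st = Some st' ->
  nsteps (k + l) P st = nsteps l P st'.
Proof. by elim: k st => [|k IH] st /=; [case=> ->|case: (step P st)]. Qed.

Lemma reaches_trans P N1 N2 st1 st2 st3 :
  reaches P N1 st1 st2 -> reaches P N2 st2 st3 -> reaches P (N1 + N2) st1 st3.
Proof.
move=> [k1 le1 H1] [k2 le2 H2]; exists (k1 + k2); first exact: leq_add.
by rewrite (nstepsD _ H1).
Qed.

Lemma reaches_leq P N1 N2 st st' : N1 <= N2 -> reaches P N1 st st' -> reaches P N2 st st'.
Proof. by move=> le12 [k le1 H]; exists k => //; apply: leq_trans le12. Qed.

(** [run] tests for halting before it looks at the fuel, so the bound on the steps is enough fuel,
    without an extra unit. *)
Lemma reaches_run P N st st' : reaches P N st st' -> step P st' = None ->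
  run N P st = Some st'.2.
Proof.
case=> k; elim: k N st => [|k IH] N st leN /= H stop.
  by case: H => ->; case: N leN => [|N] _ /=; rewrite stop.
case: N leN => [//|N]; rewrite ltnS => leN /=.
by case E: (step P st) H => [st1|//] H; apply: IH.
Qed.

Definition code_at P off (code : seq instr) :=
  forall i, i < size code -> nth IHalt P (off + i) = nth IHalt code i.

Lemma code_at_cat P off c1 c2 : code_at P off (c1 ++ c2) ->
  code_at P off c1 /\ code_at P (off + size c1) c2.
Proof.
move=> H; split=> i lti.
  by rewrite H ?nth_cat ?lti // size_cat ltn_addr.
by rewrite -addnA H ?size_cat ?ltn_add2l // nth_cat ltnNge leq_addr addKn.
Qed.

Lemma code_at_cons P off i c : code_at P off (i :: c) ->
  nth IHalt P off = i /\ code_at P off.+1 c.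
Proof.
rewrite -cat1s => /code_at_cat[/(_ 0 isT) + H]; rewrite addn0 => ->.
by split=> //; rewrite -addn1.
Qed.

Lemma code_at_sub P off code i j : code_at P off code ->
  code_at P (off + i) (take j (drop i code)).
Proof.
move=> H l; rewrite size_take_min size_drop leq_min => /andP[lj li].
by rewrite nth_take // nth_drop -addnA H //; lia.
Qed.

Lemma code_at_mid c1 c2 c3 : code_at (c1 ++ c2 ++ c3) (size c1) c2.
Proof. by move=> i lti; rewrite nth_cat ltnNge leq_addr addKn nth_cat lti. Qed.

Definition straight i :=
  match i with IJz _ _ | IJmp _ | IHalt => false | _ => true end.

Definition effect (m : ram_mem) i : ram_mem :=
  match i with
  | IConst r c => upd m r c
  | IAdd r a b => upd m r (m a + m b)
  | ISub r a b => upd m r (m a - m b)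
  | ILoad r a => upd m r (m (m a))
  | IStore a b => upd m (m a) (m b)
  | _ => m
  end.

Lemma reaches_straight P off code m : code_at P off code -> all straight code ->
  reaches P (size code) (off, m) (off + size code, foldl effect m code).
Proof.
elim: code off m => [|i c IH] off m /=; first by exists 0; rewrite ?addn0.
move=> /code_at_cons[Hi Hc] /andP[si sc].
have [k lek Hk] := IH _ (effect m i) Hc sc.
exists k.+1 => //=; rewrite addnS -addSn -Hk Hi.
by case: i si {Hi Hk}.
Qed.

Lemma reaches_jz P off a l m : nth IHalt P off = IJz a l ->
  reaches P 1 (off, m) (if m a == 0 then l else off.+1, m).
Proof. by move=> H; exists 1 => //=; rewrite H. Qed.

Lemma reaches_jmp P off l m : nth IHalt P off = IJmp l -> reaches P 1 (off, m) (l, m).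
Proof. by move=> H; exists 1 => //=; rewrite H. Qed.

(** * A loop language compiled to the RAM *)

(* CWord reads the input, backwards and clipped to its extent; CGet and CPut
   access an unbounded work array.  CFor c b body runs the body with c = b-1,
   ..., 0. *)
Inductive cmd :=
  | CConst of nat & nat
  | CAdd of nat & nat & nat
  | CSub of nat & nat & nat
  | CWord of nat & nat
  | CGet of nat & nat
  | CPut of nat & nat
  | CSeq of cmd & cmd
  | CIfz of nat & cmd & cmd
  | CFor of nat & nat & cmd.

Definition state := (ram_mem * ram_mem)%type.

Definition setv (s : state) r x : state := (upd s.1 r x, s.2).

Fixpoint countdown T k (f : nat -> T -> T) s :=
  if k is k'.+1 then countdown k' f (f k' s) else s.

Lemma countdown_ind T (I : nat -> T -> Prop) k f s :
  I k s -> (forall j s', j < k -> I j.+1 s' -> I j (f j s')) ->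
  I 0 (countdown k f s).
Proof.
elim: k s => [//|k IH] s Is If /=.
by apply: IH => [|j s' ltj]; apply: If; rewrite // ltnS ltnW.
Qed.

Fixpoint den (W : nat -> nat) (L : nat) c (s : state) : state :=
  match c with
  | CConst r k => setv s r k
  | CAdd r a b => setv s r (s.1 a + s.1 b)
  | CSub r a b => setv s r (s.1 a - s.1 b)
  | CWord r a => setv s r (W (L - s.1 a))
  | CGet r a => setv s r (s.2 (s.1 a))
  | CPut a b => (s.1, upd s.2 (s.1 a) (s.1 b))
  | CSeq c1 c2 => den W L c2 (den W L c1 s)
  | CIfz a c1 c2 => if s.1 a == 0 then den W L c1 s else den W L c2 s
  | CFor c b body =>
      countdown (s.1 b) (fun k s' => den W L body (setv s' c k)) (setv s c (s.1 b))
  end.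

Fixpoint writes c :=
  match c with
  | CConst r _ | CAdd r _ _ | CSub r _ _ | CWord r _ | CGet r _ => [:: r]
  | CPut _ _ => [::]
  | CSeq c1 c2 | CIfz _ c1 c2 => writes c1 ++ writes c2
  | CFor c _ body => c :: writes body
  end.

Fixpoint puts c :=
  match c with
  | CPut _ _ => true
  | CSeq c1 c2 | CIfz _ c1 c2 => puts c1 || puts c2
  | CFor _ _ body => puts body
  | _ => false
  end.

Lemma den_frame W L c s r : r \notin writes c -> (den W L c s).1 r = s.1 r.
Proof.
elim: c s => [r' k|r' a b|r' a b|r' a|r' a|a b|c1 IH1 c2 IH2|a c1 IH1 c2 IH2|c b body IH] s /=;
  rewrite ?inE ?mem_cat ?negb_or /upd //; try by move/negbTE->.
- by case/andP=> /IH1 H1 /IH2->.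
- by case/andP=> /IH1 H1 /IH2 H2; case: ifP.
case/andP=> rc rb; apply: (@countdown_ind _ (fun _ s' => s'.1 r = s.1 r)).
  by rewrite /= /upd (negbTE rc).
by move=> j s' _ <-; rewrite IH //= /upd (negbTE rc).
Qed.

Lemma den_arr W L c s : ~~ puts c -> (den W L c s).2 = s.2.
Proof.
elim: c s => [r' k|r' a b|r' a b|r' a|r' a|a b|c1 IH1 c2 IH2|a c1 IH1 c2 IH2|c b body IH] s /=;
  rewrite ?negb_or //.
- by case/andP=> /IH1 H1 /IH2->.
- by case/andP=> /IH1 H1 /IH2 H2; case: ifP.
by move=> pb; apply: (@countdown_ind _ (fun _ s' => s'.2 = s.2)) => // j s' _ <-; rewrite IH.
Qed.

(** Register layout: program variables below [V], then the base address of the saved block, the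
    index that [CWord] counts down from, and two scratch registers; [K] registers are reserved in
    all. *)
Local Notation V := 20.
Local Notation rB := 20.
Local Notation rL := 21.
Local Notation t1 := 22.
Local Notation t2 := 23.
Local Notation K := 24.

Fixpoint csize c :=
  match c with
  | CConst _ _ | CAdd _ _ _ | CSub _ _ _ => 1
  | CWord _ _ => 11
  | CGet _ _ | CPut _ _ => 4
  | CSeq c1 c2 => csize c1 + csize c2
  | CIfz _ c1 c2 => (csize c1 + csize c2).+2
  | CFor _ _ body => (csize body) + 6
  end.

(** Jump targets are absolute, hence the argument [off]; forward jumps use [csize], which is known
    before the code is. In [CWord], the truncated difference of [K - 2] and the word index is zero
    exactly when the word lies beyond the reserved registers. Adding a zero register stands for a
    move. *)
Fixpoint compile c off :=
  match c with
  | CConst r k => [:: IConst r k]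
  | CAdd r a b => [:: IAdd r a b]
  | CSub r a b => [:: ISub r a b]
  | CWord r a =>
      [:: ISub t1 rL a; IConst t2 (K - 2); ISub t2 t2 t1; IJz t2 (off + 8);
          IAdd t1 t1 rB; IConst t2 1; IAdd t1 t1 t2; IJmp (off + 10);
          IConst t2 2; IAdd t1 t1 t2; ILoad r t1]
  | CGet r a => [:: IConst t1 K; IAdd t1 t1 rB; IAdd t1 t1 a; ILoad r t1]
  | CPut a b => [:: IConst t1 K; IAdd t1 t1 rB; IAdd t1 t1 a; IStore t1 b]
  | CSeq c1 c2 => compile c1 off ++ compile c2 (off + csize c1)
  | CIfz a c1 c2 =>
      [:: IJz a (off + (csize c2).+2)] ++ compile c2 off.+1 ++
      [:: IJmp (off + (csize c1 + csize c2).+2)] ++ compile c1 (off + (csize c2).+2)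
  | CFor c b body =>
      [:: IConst t1 0; IAdd c b t1; IJz c (off + (csize body + 6));
          IConst t1 1; ISub c c t1] ++
      compile body (off + 5) ++ [:: IJmp (off + 2)]
  end.

Lemma size_compile c off : size (compile c off) = csize c.
Proof.
elim: c off => //= [c1 IH1 c2 IH2|a c1 IH1 c2 IH2|c b body IH] off;
  rewrite !size_cat /= ?IH1 ?IH2 ?IH; lia.
Qed.

(** A coarse upper bound: 11 is the length of the longest primitive, both branches of a test are
    charged, and [N] bounds all loop limits. *)
Fixpoint cost N c :=
  match c with
  | CSeq c1 c2 => cost N c1 + cost N c2
  | CIfz _ c1 c2 => cost N c1 + cost N c2 + 2
  | CFor _ _ body => N * (cost N body + 4) + 3
  | _ => 11
  end.

(* ro collects the loop bounds, which are never written to: they bound the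
   running time. *)
Fixpoint wf (ro : seq nat) c :=
  match c with
  | CConst r _ => (r < V) && (r \notin ro)
  | CAdd r a b | CSub r a b => [&& r < V, r \notin ro, a < V & b < V]
  | CWord r a | CGet r a => [&& r < V, r \notin ro & a < V]
  | CPut a b => (a < V) && (b < V)
  | CSeq c1 c2 => wf ro c1 && wf ro c2
  | CIfz a c1 c2 => [&& a < V, wf ro c1 & wf ro c2]
  | CFor c b body =>
      [&& c < V, c \notin ro, b < V, b \in ro, c \notin writes body & wf ro body]
  end.

Lemma wf_ro ro c r : wf ro c -> r \in ro -> r \notin writes c.
Proof.
elim: c => [r' k|r' a b|r' a b|r' a|r' a|a b|c1 IH1 c2 IH2|a c1 IH1 c2 IH2|c b body IH] /=;
  rewrite ?inE ?mem_cat ?negb_or //.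
- by case/andP=> _ H rr; apply: contraNneq H => <-.
- by case/and4P=> _ H _ _ rr; apply: contraNneq H => <-.
- by case/and4P=> _ H _ _ rr; apply: contraNneq H => <-.
- by case/and3P=> _ H _ rr; apply: contraNneq H => <-.
- by case/and3P=> _ H _ rr; apply: contraNneq H => <-.
- by case/andP=> /IH1 H1 /IH2 H2 rr; rewrite H1 ?H2.
- by case/and3P=> _ /IH1 H1 /IH2 H2 rr; rewrite H1 ?H2.
case/andP=> _ /and5P[H _ _ _ /IH Hb] rr; rewrite Hb // andbT.
by apply: contraNneq H => <-.
Qed.

(** * Simulation of loop programs by the machine *)

Section Simulation.
Variables (W : nat -> nat) (L B : nat).
Hypotheses (KB : K <= B) (LB : L + 2 < B).

(* The input word k sits at address k + 2, unless it has been saved to B + k + 1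
   to make room for the K registers in use. *)
Record rep (s : state) (m : ram_mem) : Prop := Rep {
  rep_var : forall i, i < V -> m i = s.1 i;
  rep_B : m rB = B;
  rep_L : m rL = L;
  rep_saved : forall k, k <= L -> k + 2 < K -> m (B + k + 1) = W k;
  rep_input : forall k, k <= L -> K <= k + 2 -> m (k + 2) = W k;
  rep_arr : forall j, m (B + K + j) = s.2 j }.

Ltac updtac := rewrite /upd; repeat case: eqP => ?; try lia.

Lemma rep_tmp s m t x : rep s m -> t1 <= t < K -> rep s (upd m t x).
Proof.
move=> [H1 H2 H3 H4 H5 H6] tK; split=> [i ltV|||k kL kK|k kL kK|j]; updtac; auto.
Qed.

Lemma rep_setv s m r x : rep s m -> r < V -> rep (setv s r x) (upd m r x).
Proof.
move=> [H1 H2 H3 H4 H5 H6] tK; split=> [i ltV|||k kL kK|k kL kK|j] /=; updtac; auto.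
Qed.

Lemma rep_put s m j x : rep s m -> rep (s.1, upd s.2 j x) (upd m (B + K + j) x).
Proof.
move=> [H1 H2 H3 H4 H5 H6]; split=> [i ltV|||k kL kK|k kL kK|j'] /=; updtac; auto.
Qed.

Variables (P : seq instr) (N : nat) (ro : seq nat).

(** Well-formed code never assigns to a variable of [ro], so the bound [N] on the loop limits passes
    from each state to the next and remains available at inner loops. *)
Lemma reaches_compile c off s m :
    code_at P off (compile c off) -> wf ro c -> {in ro, forall b, s.1 b <= N} ->
    rep s m ->
  exists2 m', reaches P (cost N c) (off, m) (off + csize c, m') & rep (den W L c s) m'.
Proof.
elim: c off s m => [r k|r a b|r a b|r a|r a|a b|c1 IH1 c2 IH2|a c1 IH1 c2 IH2|c b body IH]
  off s m code wfc sN Rs; rewrite /= in wfc.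
- have H := reaches_straight m code isT; exists (upd m r k); first exact: reaches_leq H.
  by apply: rep_setv => //; case/andP: wfc.
- have H := reaches_straight m code isT; eexists; first exact: reaches_leq H.
  case/and4P: wfc => ? ? ? ?.
  by rewrite /= !(rep_var Rs) //; apply: rep_setv.
- have H := reaches_straight m code isT; eexists; first exact: reaches_leq H.
  case/and4P: wfc => ? ? ? ?.
  by rewrite /= !(rep_var Rs) //; apply: rep_setv.
- case/and3P: wfc => rV _ aV.
  have := reaches_straight m (code_at_sub (i := 0) (j := 3) code) isT.
  rewrite addn0 [foldl _ _ _]/=; set m1 := upd (upd _ _ _) t2 _ => H1.
  have R1 : rep s m1 by do 3?apply: rep_tmp.
  have m1t1 : m1 t1 = L - s.1 a by rewrite /m1 /upd /= (rep_L Rs) (rep_var Rs).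
  have m1t2 : m1 t2 = K - 2 - (L - s.1 a).
    by rewrite /m1 /upd /= (rep_L Rs) (rep_var Rs).
  have Hjz := reaches_jz m1 (code 3 isT); rewrite m1t2 in Hjz.
  suff [m2 R2 [m2t1 H2]]: exists2 m2, rep s m2 & m2 (m2 t1) = W (L - s.1 a) /\
      reaches P 5 (off + 3, m1) (off + 10, m2).
    have := reaches_straight m2 (code_at_sub (i := 10) (j := 1) code) isT.
    rewrite /= m2t1 => H3; exists (upd m2 r (W (L - s.1 a))); last exact: rep_setv.
    rewrite -addnA in H3; exact: (reaches_leq _ (reaches_trans (reaches_trans H1 H2) H3)).
  (* A zero difference means that the word has address at least [K] and is still in place; otherwise
     its saved copy is read. *)
  case: eqP Hjz => E Hjz.
    have := reaches_straight m1 (code_at_sub (i := 8) (j := 2) code) isT.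
    rewrite [foldl _ _ _]/=; set m2 := upd _ t1 _ => H2.
    have R2 : rep s m2 by do 2?apply: rep_tmp.
    exists m2 => //; split; last first.
      rewrite -addnA in H2; exact: (reaches_leq _ (reaches_trans Hjz H2)).
    have -> : m2 t1 = L - s.1 a + 2 by rewrite /m2 /upd /= m1t1.
    by rewrite (rep_input R2) //; lia.
  have := reaches_straight m1 (code_at_sub (i := 4) (j := 3) code) isT.
  rewrite [foldl _ _ _]/=; set m2 := upd _ t1 _ => H2.
  have R2 : rep s m2 by do 3?apply: rep_tmp.
  exists m2 => //; split; last first.
    rewrite -addnS in Hjz; rewrite -addnA in H2.
    exact: (reaches_leq _ (reaches_trans (reaches_trans Hjz H2) (reaches_jmp _ (code 7 isT)))).
  have -> : m2 t1 = B + (L - s.1 a) + 1.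
    by rewrite /m2 /upd /= m1t1 (rep_B R1) (addnC B).
  by rewrite (rep_saved R2) //; lia.
- case/and3P: wfc => rV _ aV.
  have H := reaches_straight m code isT; eexists; first exact: reaches_leq H.
  pose m1 := foldl effect m [:: IConst t1 K; IAdd t1 t1 rB; IAdd t1 t1 a].
  rewrite [foldl _ _ _]/= -[upd (upd (upd m _ _) _ _) _ _]/m1.
  have R1 : rep s m1 by do 3?apply: rep_tmp.
  have -> : m1 t1 = B + K + s.1 a.
    by rewrite /m1 /= /upd /= (rep_B Rs) ltn_eqF ?(rep_var Rs) 1?(addnC B) // (leq_trans aV).
  by rewrite (rep_arr R1); apply: rep_setv.
- case/andP: wfc => aV bV.
  have H := reaches_straight m code isT; eexists; first exact: reaches_leq H.
  pose m1 := foldl effect m [:: IConst t1 K; IAdd t1 t1 rB; IAdd t1 t1 a].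
  rewrite [foldl _ _ _]/= -[upd (upd (upd m _ _) _ _) _ _]/m1.
  have R1 : rep s m1 by do 3?apply: rep_tmp.
  have -> : m1 t1 = B + K + s.1 a.
    by rewrite /m1 /= /upd /= (rep_B Rs) ltn_eqF ?(rep_var Rs) 1?(addnC B) // (leq_trans aV).
  by rewrite (rep_var R1) //; apply: rep_put.
- case/andP: wfc => w1 w2; have [code1 code2] := code_at_cat code.
  rewrite size_compile in code2.
  have [m1 H1 R1] := IH1 _ _ _ code1 w1 sN Rs.
  have sN1 : {in ro, forall b, (den W L c1 s).1 b <= N}.
    by move=> b bro; rewrite den_frame ?sN // (wf_ro w1).
  have [m2 H2 R2] := IH2 _ _ _ code2 w2 sN1 R1.
  by exists m2 => //; rewrite addnA; apply: reaches_trans H1 H2.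
- case/and3P: wfc => aV w1 w2; move: code => /=.
  case/code_at_cons => Hjz /code_at_cat[]; rewrite size_compile => code2.
  case/code_at_cons => Hjmp code1.
  have Hz := reaches_jz m Hjz; rewrite (rep_var Rs) // in Hz.
  rewrite [den _ _ _ _]/=; case: eqP Hz => _ Hz.
    have E : (off.+1 + csize c2).+1 = off + (csize c2).+2 by lia.
    rewrite E in code1; have [m1 H1 R1] := IH1 _ _ _ code1 w1 sN Rs.
    exists m1 => //; have := reaches_trans Hz H1.
    have -> : off + (csize c2).+2 + csize c1 = off + csize (CIfz a c1 c2) by rewrite /=; lia.
    by apply: reaches_leq; rewrite /=; lia.
  have [m1 H1 R1] := IH2 _ _ _ code2 w2 sN Rs.
  exists m1 => //; have := reaches_trans (reaches_trans Hz H1) (reaches_jmp m1 Hjmp).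
  by apply: reaches_leq; rewrite /=; lia.
case/andP: wfc => cV /and5P[cro bV bro cw wb].
have [code5 /code_at_cat[]] := @code_at_cat P off
  [:: IConst t1 0; IAdd c b t1; IJz c (off + (csize body + 6)); IConst t1 1; ISub c c t1]
  _ code.
rewrite size_compile [size _]/= => codeb /code_at_cons[Hjmp _].
have [HC0 HC1] : code_at P off [:: IConst t1 0; IAdd c b t1] /\
    code_at P (off + 3) [:: IConst t1 1; ISub c c t1].
  by split; [have := code_at_sub (i := 0) (j := 2) code5; rewrite addn0
            |exact: (code_at_sub (i := 3) (j := 2) code5)].
(* The induction enters the loop at its test. Beyond the body, a round costs four steps: the test,
   two for the decrement, and the jump back; the final 1 is the test that leaves the loop. *)
have Hloop k s1 m1 : k <= N -> s1.1 c = k -> {in ro, forall b, s1.1 b <= N} -> rep s1 m1 ->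
  exists2 m', reaches P (k * (cost N body + 4) + 1) (off + 2, m1) (off + csize (CFor c b body), m')
    & rep (countdown k (fun k s' => den W L body (setv s' c k)) s1) m'.
  elim: k s1 m1 => [|k IHk] s1 m1 kN s1c sN1 R1.
    exists m1 => //; have := reaches_jz m1 (code5 2 isT).
    by rewrite (rep_var R1) // s1c.
  have := reaches_jz m1 (code5 2 isT); rewrite (rep_var R1) // s1c /= => Hjz.
  have := reaches_straight m1 HC1 isT.
  rewrite [foldl _ _ _]/= [size _]/=; set m2 := upd _ c _ => H2.
  have R2 : rep (setv s1 c k) m2.
    have -> : m2 = upd (upd m1 t1 1) c k.
      by rewrite /m2 upd_same upd_other ?(rep_var R1) ?s1c ?subn1 // ltn_eqF ?(leq_trans cV).
    by apply: rep_setv => //; apply: rep_tmp.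
  have sN2 : {in ro, forall b, (setv s1 c k).1 b <= N}.
    move=> b' bro'; rewrite /= /upd; case: eqP => E; first by rewrite -E bro' in cro.
    exact: sN1.
  have [m3 H3 R3] := IH _ _ _ codeb wb sN2 R2.
  have s3c : (den W L body (setv s1 c k)).1 c = k by rewrite den_frame //= /upd eqxx.
  have sN3 : {in ro, forall b, (den W L body (setv s1 c k)).1 b <= N}.
    by move=> b' bro'; rewrite den_frame ?sN2 // (wf_ro wb).
  have [m4 H4 R4] := IHk _ _ (ltnW kN) s3c sN3 R3.
  exists m4 => //.
  rewrite -!addnA [3 + 2]/= in H2; rewrite -addnS in Hjz.
  apply: (reaches_leq _ (reaches_trans (reaches_trans (reaches_trans (reaches_trans Hjz H2) H3)
    (reaches_jmp m3 Hjmp)) H4)).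
  by lia.
have := reaches_straight m HC0 isT; rewrite [foldl _ _ _]/= [size _]/=; set m1 := upd _ c _ => H1.
have m1E : m1 = upd (upd m t1 0) c (s.1 b).
  by rewrite /m1 upd_same upd_other ?(rep_var Rs) ?addn0 // ltn_eqF ?(leq_trans bV).
have R1 : rep (setv s c (s.1 b)) m1 by rewrite m1E; apply: rep_setv => //; apply: rep_tmp.
have sN1 : {in ro, forall b', (setv s c (s.1 b)).1 b' <= N}.
  move=> b' bro'; rewrite /= /upd; case: eqP => E; first by rewrite -E bro' in cro.
  exact: sN.
have [||m2 H2 R2] := Hloop (s.1 b) _ _ _ _ sN1 R1; first exact: sN.
  by rewrite /= /upd eqxx.
exists m2 => //; apply: (reaches_leq _ (reaches_trans H1 H2)).
have := sN b bro; rewrite [cost N (CFor _ _ _)]/=; set x := cost _ _ + 4 => bN.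
by have := leq_mul bN (leqnn x); lia.
Qed.
End Simulation.

(** * Freeing the registers that hold the input *)

Definition fib_step := [:: IAdd 0 0 1; IAdd 1 1 0].
Definition unfib_step := [:: ISub 1 1 0; ISub 0 0 1].
(** Register 0 must hold 1 and register 1 is the moving pointer. *)
Definition save i k := flatten [seq [:: IAdd 1 1 0; IStore 1 j] | j <- iota i k].

Lemma fib_stepE m (m' := foldl effect m fib_step) :
  [/\ m' 0 = m 0 + m 1, m' 1 = m 0 + 2 * m 1 & forall i, 1 < i -> m' i = m i].
Proof.
rewrite /m' /= /upd /=; split=> //; first by lia.
by case=> [|[]].
Qed.

Lemma unfib_stepE m (m' := foldl effect m unfib_step) :
  [/\ m' 1 = m 1 - m 0, m' 0 = m 0 - (m 1 - m 0) & forall i, 1 < i -> m' i = m i].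
Proof. by rewrite /m' /= /upd /=; split=> // -[|[]]. Qed.

(** Five is the least number of steps that suffices: four would give the address 21 n + 34 m, which
    is below [K] = 24 for the one-vertex tree. *)
Definition spread := flatten (nseq 5 fib_step).
Definition unspread := flatten (nseq 5 unfib_step).

Lemma spreadE m (m' := foldl effect m spread) :
  [/\ m' 0 = 34 * m 0 + 55 * m 1, m' 1 = 55 * m 0 + 89 * m 1
    & forall i, 1 < i -> m' i = m i].
Proof.
rewrite {}/m' /spread [flatten _]/= -[X in foldl _ _ X]/(fib_step ++ fib_step ++ fib_step ++ fib_step ++ fib_step).
rewrite !foldl_cat.
have [] := fib_stepE m; move: (foldl effect m fib_step) => m1 a1 b1 c1.
have [] := fib_stepE m1; move: (foldl effect m1 fib_step) => m2 a2 b2 c2.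
have [] := fib_stepE m2; move: (foldl effect m2 fib_step) => m3 a3 b3 c3.
have [] := fib_stepE m3; move: (foldl effect m3 fib_step) => m4 a4 b4 c4.
have [a5 b5 c5] := fib_stepE m4; split; [lia | lia | move=> i i1].
by rewrite c5 ?c4 ?c3 ?c2 ?c1.
Qed.

Lemma unspreadE m (m' := foldl effect m unspread) x y :
    m 0 = 34 * x + 55 * y -> m 1 = 55 * x + 89 * y ->
  [/\ m' 0 = x, m' 1 = y & forall i, 1 < i -> m' i = m i].
Proof.
rewrite {}/m' /unspread [flatten _]/= -[X in foldl _ _ X]/(unfib_step ++ unfib_step ++ unfib_step ++ unfib_step ++ unfib_step).
rewrite !foldl_cat => a0 b0.
have [] := unfib_stepE m; move: (foldl effect m unfib_step) => m1 a1 b1 c1.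
have [] := unfib_stepE m1; move: (foldl effect m1 unfib_step) => m2 a2 b2 c2.
have [] := unfib_stepE m2; move: (foldl effect m2 unfib_step) => m3 a3 b3 c3.
have [] := unfib_stepE m3; move: (foldl effect m3 unfib_step) => m4 a4 b4 c4.
have [a5 b5 c5] := unfib_stepE m4; split; [lia | lia | move=> i i1].
by rewrite c5 ?c4 ?c3 ?c2 ?c1.
Qed.

(** The condition [i + k <= m 1] puts all targets above all sources, so nothing is overwritten
    before it is copied. *)
Lemma saveE i k m (m' := foldl effect m (save i k)) :
    1 < i -> i + k <= m 1 -> m 0 = 1 ->
  [/\ m' 0 = 1, m' 1 = m 1 + k, forall j, j < k -> m' (m 1 + j + 1) = m (i + j)
    & forall a, 1 < a -> ~~ (m 1 < a <= m 1 + k) -> m' a = m a].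
Proof.
rewrite {}/m'; elim: k i m => [|k IH] i m i1 ik m0 /=; first by rewrite addn0.
have m11 : upd m 1 (m 1 + m 0) 1 = (m 1).+1 by rewrite upd_same m0 addn1.
rewrite m11; set m1 := upd _ (m 1).+1 _.
have m1i a : a != 1 -> a != (m 1).+1 -> m1 a = m a.
  by move=> a1 am; rewrite /m1 !upd_other.
have m1_1 : m1 1 = (m 1).+1 by rewrite /m1 upd_other //; lia.
have m1_s : m1 (m 1).+1 = m i by rewrite /m1 upd_same upd_other //; lia.
have [|||H0 H1 H2 H3] := IH i.+1 m1; [lia | lia | by rewrite m1i | ].
rewrite -/(save i.+1 k); split=> //.
- by rewrite H1 m1_1; lia.
- case=> [|j] jk; last first.
    have -> : m 1 + j.+1 + 1 = m1 1 + j + 1 by rewrite m1_1; lia.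
    by rewrite H2 ?m1i ?addSnnS //; lia.
  by rewrite !addn0 addn1 H3 ?m1_s ?m1_1 //; lia.
by move=> a a1 am; rewrite H3 ?m1_1 ?m1i //; lia.
Qed.

(* Registers are freed without any spare register: the invertible Fibonacci
   steps send (n, m) to (34 n + 55 m, 55 n + 89 m), whose second component is
   an address beyond the input and the registers in use. *)
Definition prologue :=
  spread ++ [:: IStore 1 0; IConst 0 1] ++ save 2 22 ++
  [:: IConst 0 22; ISub 1 1 0; ILoad 0 1; IConst 2 0; IAdd 20 1 2] ++
  unspread ++ [:: IAdd 21 1 1; IConst 3 1; IConst 4 2; IAdd 2 0 3].

Definition input n es k := init_mem n es (k + 2).
Definition base n (es : seq (nat * nat)) := 55 * n + 89 * size es.

Lemma init_mem_beyond n es i : 2 + 2 * size es <= i -> init_mem n es i = 0.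
Proof.
move=> le; rewrite /init_mem !gtn_eqF; [|lia|lia].
by rewrite nth_default ?if_same //; lia.
Qed.

(** The work array is whatever the memory holds from [base n es + 24] on; it is not cleared, because
    [start_position] initialises the cells of all vertices. *)
Lemma prologue_rep n es (m' := foldl effect (init_mem n es) prologue) : 0 < n ->
  [/\ m' 0 = n, m' 1 = size es, m' 2 = n.+1, m' 3 = 1 & m' 4 = 2] /\
  rep (input n es) (2 * size es) (base n es) (m', fun j => m' (base n es + 24 + j)) m'.
Proof.
move=> n0; rewrite {}/m' /prologue; set e := size es; set B := base n es.
have BE : B = 55 * n + 89 * e by [].
have beyond i : B <= i -> init_mem n es i = 0.
  by move=> le; apply: init_mem_beyond; rewrite -/e; lia.
rewrite foldl_cat; have [] := spreadE (init_mem n es).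
move: (foldl effect _ spread) => m m0 m1 Hm.
have {}m1 : m 1 = B by rewrite m1.
have {}m0 : m 0 = 34 * n + 55 * e by rewrite m0.
rewrite foldl_cat; set m2 := foldl effect m [:: _; _].
have m20 : m2 0 = 1 by [].
have m21 : m2 1 = B by rewrite /m2 /= m1 !upd_other //; lia.
have m2B : m2 B = 34 * n + 55 * e by rewrite /m2 /= m1 upd_other ?upd_same //; lia.
have m2i i : 1 < i -> i != B -> m2 i = init_mem n es i.
  by move=> i1 iB; rewrite /m2 /= m1 !upd_other ?Hm //; lia.
rewrite foldl_cat; have [|m30 m31 m3s m3i] := saveE (i := 2) (k := 22) isT _ m20.
  by rewrite m21; lia.
move: (foldl effect m2 (save 2 22)) m30 m31 m3s m3i; rewrite {}m21 => m3 m30 m31 m3s m3i.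
have m3B : m3 B = 34 * n + 55 * e by rewrite m3i ?m2B //; lia.
have {}m3i a : 23 < a -> a != B -> ~~ (B < a <= B + 22) -> m3 a = init_mem n es a.
  by move=> a23 aB /m3i->; rewrite ?m2i //; lia.
rewrite foldl_cat; set m4 := foldl effect m3 [:: _; _; _; _; _].
have m4E : m4 = upd (upd (upd (upd (upd m3 0 22) 1 B) 0 (34 * n + 55 * e)) 2 0) 20 B.
  rewrite /m4 /= (_ : upd m3 0 22 1 - upd m3 0 22 0 = B); last first.
    by rewrite upd_same upd_other // m31 addnK.
  rewrite upd_same (_ : upd (upd m3 0 22) 1 B B = 34 * n + 55 * e); last first.
    by rewrite !upd_other ?m3B //; lia.
  by rewrite upd_same addn0 /upd.
have [||] := @unspreadE m4 n e; [by rewrite m4E | by rewrite m4E BE | ].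
rewrite foldl_cat; move: (foldl effect m4 unspread) => m5 m50 m51 m5i.
set m6 := foldl _ _ _.
have m6E : m6 = upd (upd (upd (upd m5 21 (2 * e)) 3 1) 4 2) 2 n.+1.
  rewrite /m6 /= m51 (_ : e + e = 2 * e); last by lia.
  by rewrite /upd /= m50 addn1.
have m6i i : 21 < i -> m6 i = m3 i.
  move=> i21; rewrite m6E !upd_other ?m5i; try lia.
  by rewrite m4E !upd_other; lia.
split; first by rewrite m6E /upd /= m50 m51.
split=> //.
- by rewrite m6E !upd_other ?m5i // m4E upd_same.
- by rewrite m6E.
- move=> k kL kK; rewrite m6i; last by lia.
  by rewrite m3s ?m2i /input ?(addnC 2) //; lia.
- by move=> k kL kK; rewrite m6i ?m3i //; rewrite -/e in kL; lia.
Qed.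

Definition program c :=
  prologue ++ compile c (size prologue) ++ [:: IConst 22 0; IAdd 0 5 22].

(** Besides the loop limits this protects the constants 1 and 2 from assignment. *)
Definition loop_bounds := [:: 0; 1; 2; 3; 4].

(** The 77 steps outside the compiled code are the 75 instructions of the prologue and the two that
    copy variable 5 to register 0. The program halts by running past its end. *)
Lemma program_run c n es F : 0 < n -> wf loop_bounds c ->
    cost (n + size es + 1) c + 77 <= F ->
  exists s : state,
    [/\ s.1 0 = n, s.1 1 = size es, s.1 2 = n.+1, s.1 3 = 1 & s.1 4 = 2] /\
    exists2 m, run F (program c) (0, init_mem n es) = Some m &
      m 0 = (den (input n es) (2 * size es) c s).1 5.
Proof.
move=> n0 wfc; set N := n + size es + 1 => NF.
have [HV R] := prologue_rep es n0.
have HP : code_at (program c) 0 prologue.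
  by have := @code_at_mid [::] prologue (compile c (size prologue) ++ [:: IConst 22 0; IAdd 0 5 22]).
have H1 := reaches_straight (init_mem n es) HP isT.
move: (foldl _ _ prologue) HV R H1 => m HV R H1; exists (m, fun j => m (base n es + 24 + j)); split=> //.
have HC : code_at (program c) (size prologue) (compile c (size prologue)).
  exact: code_at_mid.
have HE : code_at (program c) (size prologue + csize c) [:: IConst 22 0; IAdd 0 5 22].
  have := @code_at_mid (prologue ++ compile c (size prologue)) [:: IConst 22 0; IAdd 0 5 22] [::].
  by rewrite cats0 -catA size_cat size_compile.
set s : state := (m, _) in R *.
have sN : {in loop_bounds, forall b, s.1 b <= N}.
  move=> b; case: HV => e0 e1 e2 e3 e4; rewrite !inE.
  by case/or4P=> [||| /orP[]] /eqP-> /=; rewrite ?e0 ?e1 ?e2 ?e3 ?e4 /N; lia.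
have KB : 24 <= base n es by rewrite /base; lia.
have LB : 2 * size es + 2 < base n es by rewrite /base; lia.
have [m2 H2 R2] := reaches_compile KB LB HC wfc sN R.
have H3 := reaches_straight m2 HE isT.
have H := reaches_trans (reaches_trans H1 H2) H3.
exists (foldl effect m2 [:: IConst 22 0; IAdd 0 5 22]).
  apply: (reaches_run (reaches_leq _ H)); first by move: NF; rewrite [size _]/= [size _]/=; lia.
  by rewrite /= nth_default // /program !size_cat size_compile /=; lia.
by rewrite /= upd_same upd_same addn0 upd_other // (rep_var R2).
Qed.

(** Each loop raises the exponent by one, and its overhead of 4 per round and 3 in all goes into the
    constant. Exponents of successive commands are simply added. *)
Lemma cost_poly c : exists C k, forall N, 0 < N -> cost N c <= C * N ^ k.
Proof.
have leX N k l : 0 < N -> k <= l -> N ^ k <= N ^ l by move=> N0; apply: leq_pexp2l.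
elim: c => /= [a b|a b c|a b c|a b|a b|a b|c1 [C1 [k1 H1]] c2 [C2 [k2 H2]]
  |_ c1 [C1 [k1 H1]] c2 [C2 [k2 H2]]|_ _ c [C [k H]]]; try by exists 11, 0; lia.
- exists (C1 + C2), (k1 + k2) => N N0; rewrite mulnDl leq_add //.
    by apply: leq_trans (H1 N N0) _; rewrite leq_mul2l leX ?orbT ?leq_addr.
  by apply: leq_trans (H2 N N0) _; rewrite leq_mul2l leX ?orbT ?leq_addl.
- exists (C1 + C2 + 2), (k1 + k2) => N N0; rewrite !mulnDl !leq_add //.
  + by apply: leq_trans (H1 N N0) _; rewrite leq_mul2l leX ?orbT ?leq_addr.
  + by apply: leq_trans (H2 N N0) _; rewrite leq_mul2l leX ?orbT ?leq_addl.
  + by rewrite -[X in X <= _]muln1 leq_mul2l expn_gt0 N0.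
exists (C + 7), k.+1 => N N0; have := H N N0; have := leX N 0 k N0 isT.
rewrite expnS expn0; move: (N ^ k) (cost N c) => X Y X0 YX.
have : N * Y <= N * (C * X) by rewrite leq_mul2l YX orbT.
have : N <= N * X by rewrite leq_pmulr.
by nia.
Qed.

(** * Deciding the outcome *)

Declare Scope cmd_scope.
Notation "c1 ;; c2" := (CSeq c1 c2) (at level 61, right associativity) : cmd_scope.
Local Open Scope cmd_scope.

(* Variables 0-4 and 19 hold n, the number of edges, n + 1, 1, 2 and 0; 5 holds
   the result, 6 the first move x (n for none), 13 and 14 the pair (u, v) under
   trial, 16 whether it is blocked, 17 whether u and v are adjacent, 18 the
   verdict for x.  Array cells are 0 for a deleted vertex, 1 for a vertex of Q,
   and 2 for any other vertex. *)
Definition skip := CConst 11 0.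
(** The two truncated differences add up to the distance |x - y|, which is zero exactly for equal
    values. *)
Definition ifeq x y c1 c2 := CSub 11 x y;; CSub 12 y x;; CAdd 11 11 12;; CIfz 11 c1 c2.

(* The j-th edge from the end is read into variables 9 and 10. *)
Definition for_edges body :=
  CFor 8 1 (CAdd 11 8 8;; CAdd 11 11 3;; CWord 10 11;; CAdd 11 11 3;; CWord 9 11;; body).

Definition mark_neighbours := ifeq 9 6 (CPut 10 3) skip;; ifeq 10 6 (CPut 9 3) skip.

(** For x = n the deleted cell belongs to no vertex and no edge has [n] as an end, so the same code
    sets up the initial position. *)
Definition start_position := CFor 7 2 (CPut 7 4);; CPut 6 19;; for_edges mark_neighbours.

Definition scan_neighbour w :=
  ifeq w 14 (CConst 17 1) (CGet 11 w;; CIfz 11 skip (CConst 16 1)).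
Definition scan_edge :=
  ifeq 9 13 (scan_neighbour 10) skip;; ifeq 10 13 (scan_neighbour 9) skip.

(** Cells are at most 2, so 2 minus the cell of [u] is zero exactly when [u] is present and outside
    [Q]; any other value blocks the pair from the start. *)
Definition try_pair :=
  CGet 11 13;; CSub 16 4 11;; CGet 11 14;; CIfz 11 (CConst 16 1) skip;; CConst 17 0;;
  for_edges scan_edge;;
  CIfz 17 skip (CIfz 16 (CPut 13 19;; CPut 14 19) skip).

Definition reduce_all := CFor 15 0 (CFor 13 0 (CFor 14 0 try_pair)).

Definition check :=
  CConst 18 1;; CFor 7 0 (CGet 11 7;; CSub 11 11 3;; CIfz 11 skip (CConst 18 0)).

(** Variable 6 counts down from [n], so Dominator's win as second player is recorded as 0 before any
    first move is tried. A winning first move later turns 1 into 2 but leaves 0 alone. *)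
Definition record_result :=
  CIfz 18 skip (ifeq 6 0 (CConst 5 0) (CIfz 5 skip (CConst 5 2))).

Definition main :=
  CConst 19 0;; CConst 5 1;;
  CFor 6 2 (start_position;; reduce_all;; check;; record_result).

Lemma wf_main : wf loop_bounds main.
Proof. by []. Qed.

(** * What the program computes on a valid edge list *)

Section Correctness.
Variables (n : nat) (es : seq (nat * nat)).
Hypothesis valid : valid_edges n es.
Local Notation den := (den (input n es) (2 * size es)).

Definition consts (s : state) :=
  [/\ s.1 0 = n, s.1 1 = size es, s.1 2 = n.+1 & [/\ s.1 3 = 1, s.1 4 = 2 & s.1 19 = 0]].

Definition const_vars := [:: 0; 1; 2; 3; 4; 19].

Lemma consts_ext s s' : {in const_vars, s'.1 =1 s.1} -> consts s -> consts s'.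
Proof. by move=> E [H0 H1 H2 [H3 H4 H5]]; split; [| | |split]; rewrite E. Qed.

Lemma consts_den c s : ~~ has (mem (writes c)) const_vars -> consts s -> consts (den c s).
Proof.
move=> /hasPn H; apply: consts_ext => r /H rw; exact: den_frame.
Qed.

Lemma consts_setv s r x : r \notin const_vars -> consts s -> consts (setv s r x).
Proof.
move=> H; apply: consts_ext => r' r'c /=; apply: upd_other.
by apply: contraNneq H => <-.
Qed.

Lemma den_ifeq (x y : nat) c1 c2 (s : state) : x \notin [:: 11; 12] -> y \notin [:: 11; 12] ->
  exists2 s' : state, s'.2 = s.2 /\ (forall r, r \notin [:: 11; 12] -> s'.1 r = s.1 r) &
    den (ifeq x y c1 c2) s = den (if s.1 x == s.1 y then c1 else c2) s'.
Proof.
rewrite !inE !negb_or => /andP[x11 x12] /andP[y11 y12].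
exists (den (CSub 11 x y;; CSub 12 y x;; CAdd 11 11 12) s).
  split=> // r; rewrite !inE !negb_or => /andP[r11 r12].
  by rewrite den_frame // !inE !negb_or r11 r12.
rewrite /ifeq /=.
rewrite (_ : upd _ 11 _ 11 == 0 = (s.1 x == s.1 y)); first by case: eqP.
rewrite /upd /= (negbTE x11) (negbTE y11); move: (s.1 x) (s.1 y) => a b; lia.
Qed.

Lemma input_fst i : input n es (2 * i) = (nth (0, 0) es i).1.
Proof.
rewrite /input /init_mem !gtn_eqF ?addn2 // !subSS subn0 mul2n odd_double.
by rewrite doubleK.
Qed.

Lemma input_snd i : input n es (2 * i).+1 = (nth (0, 0) es i).2.
Proof.
rewrite /input /init_mem !gtn_eqF ?addn2 // !subSS subn0 mul2n /= odd_double /=.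
by rewrite -[X in uphalf X]/(i.*2) uphalf_double.
Qed.

(** The counter descends while [CWord] reads from the end, so the edges arrive in the order of [es]
    and the invariant can be indexed by the prefix already read. *)
Lemma for_edges_ind (I : seq (nat * nat) -> state -> Prop) body s :
    consts s -> ~~ has (mem (writes body)) (8 :: const_vars) ->
    (forall s', s'.2 = s.2 -> (forall r, r != 8 -> s'.1 r = s.1 r) -> I [::] s') ->
    (forall l p s1 s2, p \in es -> consts s2 -> I l s1 ->
       s2.2 = s1.2 -> (forall r, r \notin [:: 8; 9; 10; 11] -> s2.1 r = s1.1 r) ->
       s2.1 9 = p.1 -> s2.1 10 = p.2 -> I (rcons l p) (den body s2)) ->
  I es (den (for_edges body) s).
Proof.
move=> cs; rewrite /= negb_or => /andP[w8 wc] I0 Istep; have [_ s1 _ _] := cs.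
suff [] : consts (den (for_edges body) s) /\
    I (take (size es - 0) es) (den (for_edges body) s) by rewrite subn0 take_size.
apply: (@countdown_ind _ (fun j s' => consts s' /\ I (take (size es - j) es) s')).
  split; first exact: consts_setv.
  by rewrite s1 subnn take0; apply: I0 => //= r r8; apply: upd_other.
rewrite s1 => j s' jm [cs' Is'].
set s2 := den (CAdd 11 8 8;; CAdd 11 11 3;; CWord 10 11;; CAdd 11 11 3;; CWord 9 11)
  (setv s' 8 j).
change (consts (den body s2) /\ I (take (size es - j) es) (den body s2)).
have cs2 : consts s2 by apply: consts_den => //; apply: consts_setv.
split; first exact: consts_den.
have [_ _ _ [s'3 _ _]] := cs'.
have jE : (size es - j) = (size es - j.+1).+1 by lia.
have jlt : size es - j.+1 < size es by lia.
rewrite jE (take_nth (0, 0)) //.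
apply: (Istep _ _ s') => //; first exact: mem_nth.
- move=> r; rewrite !inE !negb_or => /and4P[r8 r9 r10 r11].
  by rewrite den_frame ?inE ?negb_or ?r9 ?r10 ?r11 //= upd_other.
- rewrite -input_fst /s2 /= /upd /= s'3; congr (input n es _); lia.
- rewrite -input_snd /s2 /= /upd /= s'3; congr (input n es _); lia.
Qed.

(** The adjacency of [graph_of] on plain numbers, so that it applies to a prefix of the edge list
    and to the value [n]. *)
Definition joins (l : seq (nat * nat)) u v := ((u, v) \in l) || ((v, u) \in l).

Lemma joins_rcons l p u v : joins (rcons l p) u v =
  joins l u v || ((p.1 == u) && (p.2 == v) || (p.2 == u) && (p.1 == v)).
Proof.
case: p => a b; rewrite /joins !mem_rcons !inE !xpair_eqE /=.
rewrite (eq_sym u) (eq_sym v) [(v == a) && _]andbC (eq_sym v) (eq_sym u).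
by rewrite orbACA orbC.
Qed.

Lemma valid_edge p : p \in es -> [/\ p.1 < n, p.2 < n & p.1 != p.2].
Proof. by move/(allP valid)/and3P. Qed.

Lemma den_mark_neighbours s : consts s ->
  (den mark_neighbours s).2 =
  let A := if s.1 9 == s.1 6 then upd s.2 (s.1 10) 1 else s.2 in
  if s.1 10 == s.1 6 then upd A (s.1 9) 1 else A.
Proof.
move=> [_ _ _ [s3 _ _]].
have [//|//|s1 [A1 V1] E1] := den_ifeq (x := 9) (y := 6) (CPut 10 3) skip s.
have [//|//|s2 [A2 V2] E2] := den_ifeq (x := 10) (y := 6) (CPut 9 3) skip
  (den (ifeq 9 6 (CPut 10 3) skip) s).
rewrite -[LHS]/(den (ifeq 10 6 (CPut 9 3) skip) (den (ifeq 9 6 (CPut 10 3) skip) s)).2.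
have F r : r \notin [:: 11; 12] -> (den (ifeq 9 6 (CPut 10 3) skip) s).1 r = s.1 r.
  by rewrite !inE negb_or => /andP[a b]; rewrite den_frame //= !inE !negb_or a b.
rewrite E2 !F //; case: ifP => _ /=; rewrite ?V2 ?F //= A2 E1; case: ifP => _ /=;
  by rewrite A1 ?V1 ?s3.
Qed.

(** The two ends of a valid edge differ, so marking the neighbours never revives the deleted cell of
    the first move. *)
Lemma start_position_arr s : consts s -> forall w, w < n ->
  (den start_position s).2 w =
  if w == s.1 6 then 0 else if joins es (s.1 6) w then 1 else 2.
Proof.
move=> cs; set s1 := den (CFor 7 2 (CPut 7 4)) s.
have [_ _ s2 [s3 s4 s19]] := cs.
have cs1 : consts s1 by apply: consts_den.
have s16 : s1.1 6 = s.1 6 by apply: den_frame.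
have A1 : forall w, 0 <= w < n.+1 -> s1.2 w = 2.
  suff [] : s1.1 4 = 2 /\ forall w, 0 <= w < n.+1 -> s1.2 w = 2 by [].
  apply: (@countdown_ind _ (fun k s' => s'.1 4 = 2 /\ forall w, k <= w < n.+1 -> s'.2 w = 2)).
    by split=> // w; rewrite s2; lia.
  move=> j s' _ [s'4 H]; split=> // w wj; rewrite /= /upd /=.
  by case: eqP => [_|ne]; [exact: s'4|apply: H; lia].
set s2' := den (CPut 6 19) s1.
have cs2 : consts s2' by apply: consts_den.
have [_ _ _ [_ _ s1_19]] := cs1.
move: (s.1 6) s16 => x s16.
pose I l (s' : state) := s'.1 6 = x /\ forall w, w < n ->
  s'.2 w = if w == x then 0 else if joins l x w then 1 else 2.
suff [] : I es (den (for_edges mark_neighbours) s2') by [].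
apply: for_edges_ind => // [s' A' V'|l p s1' s2'' /valid_edge[p1 p2 p12] cs2'' [I6 IA] A' V' V9 V10].
  split; first by rewrite V'.
  move=> w wn; rewrite A' /= s16 s1_19 /upd; case: eqP => // _.
  by apply: A1; lia.
have s6 : s2''.1 6 = x by rewrite V'.
split; first by rewrite den_frame.
move=> w wn; rewrite den_mark_neighbours // V9 V10 s6 A' joins_rcons /=.
have := IA w wn; rewrite /upd.
case: (eqVneq p.1 x) => E1; case: (eqVneq p.2 x) => E2; rewrite /= ?orbF.
- by rewrite E1 E2 eqxx in p12.
- by rewrite (eq_sym p.2 w); case: (eqVneq w p.2) => [->|_]; rewrite ?orbF ?orbT ?(negbTE E2).
- by rewrite (eq_sym p.1 w); case: (eqVneq w p.1) => [->|_]; rewrite ?orbF ?orbT ?(negbTE E1).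
- by [].
Qed.

Lemma den_scan_neighbour w s (s' := den (scan_neighbour w) s) : w \in [:: 9; 10] ->
  [/\ s'.2 = s.2, s'.1 17 = if s.1 w == s.1 14 then 1 else s.1 17
    & s'.1 16 = if (s.1 w != s.1 14) && (s.2 (s.1 w) != 0) then 1 else s.1 16].
Proof.
rewrite {}/s' => w910.
have w11 : w \notin [:: 11; 12] by move: w910; rewrite !inE => /orP[] /eqP->.
have [//|s1 [A1 V1] ->] := den_ifeq (y := 14) (CConst 17 1)
  (CGet 11 w;; CIfz 11 skip (CConst 16 1)) s w11.
case: eqP => _ /=; first by rewrite /upd /= V1.
by rewrite upd_same A1 V1 //; case: eqP => _; rewrite /= /upd /= ?V1.
Qed.

Lemma den_scan_edge s (s' := den scan_edge s) :
  [/\ s'.2 = s.2,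
      s'.1 17 = if (s.1 9 == s.1 13) && (s.1 10 == s.1 14) ||
                   (s.1 10 == s.1 13) && (s.1 9 == s.1 14) then 1 else s.1 17
    & s'.1 16 = if [&& s.1 9 == s.1 13, s.1 10 != s.1 14 & s.2 (s.1 10) != 0] ||
                   [&& s.1 10 == s.1 13, s.1 9 != s.1 14 & s.2 (s.1 9) != 0] then 1
                else s.1 16].
Proof.
have half a b (s0 : state) (s1 := den (ifeq a 13 (scan_neighbour b) skip) s0) :
    a \in [:: 9; 10] -> b \in [:: 9; 10] ->
  [/\ s1.2 = s0.2,
      s1.1 17 = if (s0.1 a == s0.1 13) && (s0.1 b == s0.1 14) then 1 else s0.1 17,
      s1.1 16 = if [&& s0.1 a == s0.1 13, s0.1 b != s0.1 14 & s0.2 (s0.1 b) != 0] then 1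
                else s0.1 16
    & {in [:: 9; 10; 13; 14], s1.1 =1 s0.1}].
  rewrite {}/s1 => Ha Hb.
  have a11 : a \notin [:: 11; 12] by move: Ha; rewrite !inE => /orP[] /eqP->.
  have b11 : b \notin [:: 11; 12] by move: Hb; rewrite !inE => /orP[] /eqP->.
  have [//|s1 [A1 V1] E] := den_ifeq (y := 13) (scan_neighbour b) skip s0 a11.
  have F : {in [:: 9; 10; 13; 14], (den (ifeq a 13 (scan_neighbour b) skip) s0).1 =1 s0.1}.
    by move=> r; rewrite !inE => /or4P[] /eqP->; rewrite den_frame.
  split=> //; rewrite E; case: eqP => _ //=.
  - by have [-> _ _] := den_scan_neighbour s1 Hb.
  - by have [_ -> _] := den_scan_neighbour s1 Hb; rewrite !V1.
  - by rewrite /upd /= V1.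
  - by have [_ _ ->] := den_scan_neighbour s1 Hb; rewrite A1 !V1.
  - by rewrite /upd /= V1.
have [A1 a1 b1 V1] := half 9 10 s isT isT.
have [A2 a2 b2 V2] := half 10 9 (den (ifeq 9 13 (scan_neighbour 10) skip) s) isT isT.
rewrite {}/s' -[den scan_edge s]/(den (ifeq 10 13 (scan_neighbour 9) skip)
  (den (ifeq 9 13 (scan_neighbour 10) skip) s)).
rewrite A2 a2 b2 A1 a1 b1 !V1 //; split=> //.
  by case: ifP; rewrite ?orbT // orbF.
by case: ifP; rewrite ?orbT // orbF.
Qed.

(** * The deletion procedure and its verdict *)

Local Notation e := (graph_of n es).

Definition represents (Q A : {set 'I_n}) (a : ram_mem) :=
  forall w : 'I_n, a w = if w \in A then if w \in Q then 1 else 2 else 0.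

Lemma try_pair_represents s Q A (u v : 'I_n) :
    consts s -> s.1 13 = u -> s.1 14 = v -> represents Q A s.2 ->
  represents Q (if redex e Q A u v then A :\ u :\ v else A) (den try_pair s).2.
Proof.
move=> cs su sv HA; set a := s.2 in HA.
set s1 := den (CGet 11 13;; CSub 16 4 11;; CGet 11 14;; CIfz 11 (CConst 16 1) skip;;
  CConst 17 0) s.
have cs1 : consts s1 by apply: consts_den.
have s1a : s1.2 = a by apply: den_arr.
have s1u : s1.1 13 = u by rewrite -su; apply: den_frame.
have s1v : s1.1 14 = v by rewrite -sv; apply: den_frame.
have s1_17 : s1.1 17 = 0 by rewrite /s1 /= upd_same.
have [_ _ _ [_ s4 _]] := cs.
have s1_16 : (s1.1 16 == 0) = [&& u \in A, u \notin Q & v \in A].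
  rewrite /s1 /= upd_other // [X in if X then _ else _](_ : _ = (a v == 0)); last first.
    by rewrite /upd /= sv.
  have := HA u; have := HA v; case: ifP => [vA|vA] ->.
    have -> : ((if v \in Q then 1 else 2) == 0) = false by case: ifP.
    rewrite /upd /= su s4 -/a => ->.
    by case: ifP => uA; first case: ifP.
  by rewrite /= upd_same !andbF.
(* Such an edge shows that [u] has a neighbour other than [v] left. *)
pose blocks (p : nat * nat) := [&& p.1 == u, p.2 != v & a p.2 != 0] ||
  [&& p.2 == u, p.1 != v & a p.1 != 0].
pose I l (s' : state) := [/\ s'.2 = a, s'.1 13 = u, s'.1 14 = v, (s'.1 17 != 0) = joins l u v
  & (s'.1 16 != 0) = (s1.1 16 != 0) || has blocks l].
set s2 := den (for_edges scan_edge) s1.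
have [s2a s2u s2v s2_17 s2_16] : I es s2.
  apply: for_edges_ind => // [s' A' V'|l p s1' s2' pes cs2 [I1 I2 I3 I4 I5] A' V' V9 V10].
    by split; rewrite ?A' ?V' //= ?orbF // s1_17.
  have [Ha H17 H16] := den_scan_edge s2'.
  split; [by rewrite Ha A' | by rewrite den_frame ?V' | by rewrite den_frame ?V' | | ].
    by rewrite H17 V9 V10 !V' // I2 I3 joins_rcons -I4; case: ifP; rewrite ?orbT ?orbF.
  rewrite H16 V9 V10 A' !V' // I1 I2 I3 has_rcons -/(blocks p) orbCA -I5.
  by case: (blocks p).
have cs2 : consts s2 by apply: consts_den.
have [_ _ _ [_ _ s2_19]] := cs2.
have redexE : redex e Q A u v = (s2.1 17 != 0) && (s2.1 16 == 0).
  rewrite s2_17 -[_ == 0]negbK s2_16 negb_or negbK s1_16 /redex.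
  case: (u \in A); case: (u \notin Q); case: (v \in A); rewrite ?andbF //=.
  rewrite -[graph_of n es u v]/(joins es u v); congr (_ && _).
  apply/forall_inP/hasPn => H.
    case=> p q pq; have [/= pn qn _] := valid_edge pq.
    rewrite /blocks /= negb_or !negb_and !negbK.
    have key (w : 'I_n) : joins es u w -> (w == v :> nat) || (a w == 0).
      move=> uw; have := HA w; case: ifP => [wA _|_ ->]; last by rewrite orbT.
      by have := H w wA; rewrite -[graph_of n es u w]/(joins es u w) uw => /eqP->; rewrite eqxx.
    apply/andP; split.
      case: eqP => [pu|//]; apply: (key (Ordinal qn)).
      by rewrite /joins /= -pu pq.
    case: eqP => [qu|//]; apply: (key (Ordinal pn)).
    by rewrite /joins /= -qu pq orbT.
  move=> w wA; apply/implyP => uw; apply/eqP/val_inj/eqP => /=; apply/negPn/negP => wv.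
  have aw : a w != 0 by rewrite HA wA; case: ifP.
  case/orP: uw => /H; rewrite /blocks /= eqxx wv aw ?orbT //.
rewrite -[den try_pair s]/(den (CIfz 17 skip (CIfz 16 (CPut 13 19;; CPut 14 19) skip)) s2).
rewrite redexE /=; case: eqP => _ /=; first by rewrite s2a.
case: eqP => _ /=; last by rewrite s2a.
move=> w; rewrite s2a s2u s2v s2_19 /upd !inE -!val_eqE /=.
by do 2?case: eqP => //= _.
Qed.

(** A round that changes nothing has tested all pairs against one and the same set, which is
    therefore irreducible. Any other round removes a vertex, so after [n] rounds the set is
    irreducible or empty. *)
Lemma reduce_all_represents s Q A : consts s -> represents Q A s.2 ->
  exists B, [/\ reduces e Q A B, irreducible e Q B & represents Q B (den reduce_all s).2].
Proof.
move=> cs HA; have [s0 _ _ _] := cs.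
have inner s1 C (u : 'I_n) : consts s1 -> s1.1 13 = u -> represents Q C s1.2 ->
  exists B, [/\ reduces e Q C B, B = C -> forall v, ~~ redex e Q C u v
    & represents Q B (den (CFor 14 0 try_pair) s1).2].
  move=> cs1 s1u HC; have [s1_0 _ _ _] := cs1.
  pose I k (s' : state) := [/\ consts s', s'.1 13 = u & exists B,
    [/\ reduces e Q C B, B = C -> forall v : 'I_n, k <= v -> ~~ redex e Q C u v
      & represents Q B s'.2]].
  suff [_ _ [B [H1 H2 H3]]] : I 0 (den (CFor 14 0 try_pair) s1).
    by exists B; split=> // /H2 H v; apply: H.
  apply: (@countdown_ind _ I).
    split; [exact: consts_setv | by [] | exists C; split=> // [|_ v]].
      exact: reduces_refl.
    by rewrite s1_0 leqNgt ltn_ord.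
  rewrite s1_0 => k s' kn [cs' s'u [B [rB irrB HB]]]; pose v := Ordinal kn.
  have cs'' : consts (setv s' 14 k) by apply: consts_setv.
  split; [exact: (consts_den (c := try_pair) isT cs'') | | ].
    by rewrite (den_frame _ _ (c := try_pair)).
  have := try_pair_represents (v := v) cs'' s'u erefl HB.
  case: ifP => [red|nred] HB'; [exists (B :\ u :\ v) | exists B]; split=> //.
  - exact: reduces_rcons.
  (* After a deletion the set cannot equal [C] again, since [u] is gone for good. *)
  - move=> BC; have := reduces_sub rB; rewrite -BC => /subsetP/(_ u).
    by case/and5P: red => ->; rewrite !inE eqxx andbF => _ _ _ _ /(_ isT).
  move=> BC w; rewrite leq_eqVlt => /orP[/eqP kw|kw]; last exact: irrB.
  by rewrite -BC (_ : w = v) ?nred //; apply: val_inj.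
have round s1 C : consts s1 -> represents Q C s1.2 ->
  exists B, [/\ reduces e Q C B, B = C -> irreducible e Q C
    & represents Q B (den (CFor 13 0 (CFor 14 0 try_pair)) s1).2].
  move=> cs1 HC; have [s1_0 _ _ _] := cs1.
  pose I k (s' : state) := consts s' /\ exists B,
    [/\ reduces e Q C B, B = C -> forall u v : 'I_n, k <= u -> ~~ redex e Q C u v
      & represents Q B s'.2].
  suff [_ [B [H1 H2 H3]]] : I 0 (den (CFor 13 0 (CFor 14 0 try_pair)) s1).
    by exists B; split=> // /H2 H u v; apply: H.
  apply: (@countdown_ind _ I).
    split; [exact: consts_setv | exists C; split=> // [|_ u v]].
      exact: reduces_refl.
    by rewrite s1_0 leqNgt ltn_ord.
  rewrite s1_0 => k s' kn [cs' [B [rB irrB HB]]]; pose u := Ordinal kn.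
  have cs'' : consts (setv s' 13 k) by apply: consts_setv.
  split; first exact: (consts_den (c := CFor 14 0 try_pair) isT cs'').
  have [B' [rB' irrB' HB']] := inner _ _ u cs'' erefl HB.
  exists B'; split=> //; first exact: reduces_trans rB'.
  move=> B'C; have BC : B = C.
    by apply/eqP; rewrite eqEsubset (reduces_sub rB) -B'C (reduces_sub rB').
  move=> w v; rewrite leq_eqVlt => /orP[/eqP kw|kw]; last exact: irrB.
  by rewrite -BC (_ : w = u) ?irrB' ?BC //; apply: val_inj.
pose I k (s' : state) := consts s' /\ exists B,
  [/\ reduces e Q A B, irreducible e Q B \/ #|B| <= k & represents Q B s'.2].
suff [_ [B [H1 H2 H3]]] : I 0 (den reduce_all s).
  exists B; split=> //; case: H2 => //; rewrite leqn0 cards_eq0 => /eqP-> u v.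
  by rewrite /redex inE.
apply: (@countdown_ind _ I).
  split; [exact: consts_setv | exists A; split=> //; first exact: reduces_refl].
  by right; rewrite s0 -[X in _ <= X]card_ord max_card.
move=> k s' _ [cs' [B [rB irrB HB]]].
have cs'' : consts (setv s' 15 k) by apply: consts_setv.
split; first exact: (consts_den (c := CFor 13 0 (CFor 14 0 try_pair)) isT cs'').
have [B' [rB' irrB' HB']] := round _ _ cs'' HB.
exists B'; split=> //; first exact: reduces_trans rB'.
have [E|ne] := eqVneq B' B; first by left; rewrite E; apply: irrB'.
case: irrB => [irrB|cB]; first by rewrite (irreducible_eq irrB rB') eqxx in ne.
right; rewrite -ltnS; apply: leq_trans cB; apply: proper_card.
by rewrite properEneq ne (reduces_sub rB').
Qed.

Lemma check_represents s Q A : consts s -> represents Q A s.2 ->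
  ((den check s).1 18 != 0) = (A \subset Q).
Proof.
move=> cs HA; have [s0 _ _ [s3 _ _]] := cs.
pose I k (s' : state) := [/\ s'.1 3 = 1, s'.2 = s.2 &
  (s'.1 18 != 0) = [forall w : 'I_n, (k <= w) && (w \in A) ==> (w \in Q)]].
suff [_ _ ->] : I 0 (den check s).
  by apply/forall_inP/subsetP => H w; apply: H.
apply: (@countdown_ind _ I).
  split=> //; rewrite /= /upd /=; apply/esym/forallP => w.
  by rewrite s0 leqNgt ltn_ord.
move=> k s' kn0 [s'3 s'A s'18]; have kn : k < n by rewrite -s0.
set s'' := den (CGet 11 7;; CSub 11 11 3;; CIfz 11 skip (CConst 18 0)) (setv s' 7 k).
change (I k s''); have [s''3 s''A] : s''.1 3 = 1 /\ s''.2 = s.2.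
  by rewrite /s'' den_frame // den_arr.
split=> //.
have -> : (s''.1 18 != 0) = (s'.1 18 != 0) && (s.2 k != 2).
  have : s.2 k <= 2 by rewrite (HA (Ordinal kn)); case: ifP => // _; case: ifP.
  rewrite /s'' /= /upd /= s'3 s'A.
  by case: (s.2 k) => [|[|[|]]] //= _; rewrite ?andbT ?andbF.
rewrite s'18 (HA (Ordinal kn)).
apply/andP/forallP => [[/forallP H1 H2] w|H].
  rewrite leq_eqVlt andb_orl; apply/implyP => /orP[]; last exact/implyP.
  case/andP=> /eqP kw wA; have E : Ordinal kn = w by apply: val_inj.
  by move: H2; rewrite E wA; case: ifP.
split; last first.
  by have := H (Ordinal kn); rewrite /= leqnn /=; case: ifP => // _ /= ->.
by apply/forallP => w; apply/implyP => /andP[kw wA]; have := H w; rewrite ltnW ?wA.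
Qed.

(* For x = n this is the initial position, for x < n the position after
   Dominator's first move x. *)
Definition position x : {set 'I_n} := [set w : 'I_n | w == x :> nat].
Definition second_wins x := dom_wins e #|~: position x| (position x) set0 false.

(** * From the verdicts to the outcome *)

Hypothesis tree : is_tree e.

Lemma position_ord (x : 'I_n) : position x = [set x].
Proof. by apply/setP => w; rewrite !inE. Qed.

Lemma position_n : position n = set0.
Proof. by apply/setP => w; rewrite !inE ltn_eqF. Qed.

(** The cases x = n and x < n give the two admissible forms of [Q]: empty, because valid edges avoid
    [n], or the neighbourhood of a vertex already played. *)
Lemma second_winsE x B (Q := [set w : 'I_n | joins es x w]) :
  x <= n -> reduces e Q (~: position x) B -> irreducible e Q B ->
  second_wins x = (B \subset Q).
Proof.
move=> xn rB irrB; apply: (reduced_dom_wins tree rB irrB).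
- by rewrite setU0 setCK.
- move=> z; rewrite !inE => zx; apply/dominatedP/idP => [[|[u]]|].
  + by rewrite inE (negbTE zx).
  + by rewrite inE => /eqP<-.
  move=> xz; have xn' : x < n.
    by case/orP: xz => /valid_edge[].
  by right; exists (Ordinal xn'); rewrite ?inE.
- by move=> z; rewrite setCK => zx; apply/dominatedP; left.
move: xn; rewrite leq_eqVlt => /orP[/eqP xE|xn]; [left|right].
  apply/setP => w; rewrite !inE xE; apply/negbTE/negP.
  by case/orP=> /valid_edge[]; rewrite /= ?ltnn.
by exists (Ordinal xn); rewrite ?inE ?eqxx //; apply/setP => w; rewrite !inE.
Qed.

Lemma den_record_result s : consts s ->
  (den record_result s).1 5 =
  if s.1 18 == 0 then s.1 5 else if s.1 6 == n then 0 else if s.1 5 == 0 then 0 else 2.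
Proof.
move=> [s0 _ _ _]; rewrite /record_result; set c := ifeq _ _ _ _.
rewrite -[LHS]/((if s.1 18 == 0 then den skip s else den c s).1 5).
case: eqP => // _; rewrite {}/c.
have [//|//|s1 [_ V1] ->] := den_ifeq (x := 6) (y := 0) (CConst 5 0)
  (CIfz 5 skip (CConst 5 2)) s.
rewrite s0; case: eqP => //= _; rewrite V1 //; case: eqP => //= s5.
by rewrite upd_other // V1.
Qed.

Lemma den_main s : [/\ s.1 0 = n, s.1 1 = size es, s.1 2 = n.+1, s.1 3 = 1 & s.1 4 = 2] ->
  (den main s).1 5 =
  if second_wins n then 0 else if [exists x : 'I_n, second_wins x] then 2 else 1.
Proof.
case=> s0 s1 s2 s3 s4.
set body := start_position;; reduce_all;; check;; record_result.
have step s' : consts s' -> s'.1 6 <= n -> (den body s').1 5 =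
    if second_wins (s'.1 6)
    then if s'.1 6 == n then 0 else if s'.1 5 == 0 then 0 else 2 else s'.1 5.
  move=> cs' xn.
  set x := s'.1 6 in xn *.
  set sa := den start_position s'; set sb := den reduce_all sa; set sc := den check sb.
  have csa : consts sa by apply: consts_den.
  have csb : consts sb by apply: consts_den.
  have csc : consts sc by apply: consts_den.
  pose Q := [set w : 'I_n | joins es x w].
  have HA : represents Q (~: position x) sa.2.
    move=> w; rewrite (start_position_arr cs') // -/x !inE.
    by case: eqP.
  have [B [rB irrB HB]] := reduce_all_represents csa HA.
  have ok := check_represents csb HB.
  rewrite -[LHS]/((den record_result sc).1 5) den_record_result //.
  have -> : sc.1 5 = s'.1 5 by rewrite /sc /sb /sa !den_frame.
  have -> : sc.1 6 = x by rewrite /sc /sb /sa !den_frame.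
  by rewrite -[_ == 0]negbK ok (second_winsE xn rB irrB); case: (B \subset Q).
(* The value k = n + 1 describes the state in which nothing has been tried; from k = n on, the game
   with Staller moving first is settled. *)
pose I k (s' : state) := consts s' /\ s'.1 5 =
  if k == n.+1 then 1 else
  if second_wins n then 0
  else if [exists x : 'I_n, (k <= x) && second_wins x] then 2 else 1.
suff [_ ->] : I 0 (den main s) by [].
apply: (@countdown_ind _ I).
  split; last by rewrite /= /upd /= s2 eqxx.
  by split; [| | |split]; rewrite /= /upd.
move=> k s' kn0 [cs' s'5]; have {kn0} kn : k <= n by move: kn0; rewrite /= /upd /= s2.
have cs'' : consts (setv s' 6 k) by apply: consts_setv.
split; first exact: (consts_den (c := body) isT cs'').
rewrite ltn_eqF ?ltnS //; have := step _ cs'' kn; rewrite [(setv _ _ _).1 6]/= upd_same => ->.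
rewrite [(setv _ _ _).1 5]/= upd_other // s'5 eqSS.
have [->|kn'] := eqVneq k n.
  case: ifP => // _; case: ifP => // /existsP[x /andP[]].
  by rewrite leqNgt ltn_ord.
have {}kn : k < n by rewrite ltn_neqAle kn'.
case: (second_wins n); first by case: ifP.
have -> : [exists x : 'I_n, (k <= x) && second_wins x] =
    second_wins k || [exists x : 'I_n, (k < x) && second_wins x].
  apply/existsP/orP => [[x /andP[]]|[wk|/existsP[x /andP[kx wx]]]].
  - rewrite leq_eqVlt => /orP[/eqP->|kx wx]; [by left|right].
    by apply/existsP; exists x; rewrite kx.
  - by exists (Ordinal kn); rewrite /= leqnn.
  - by exists x; rewrite ltnW.
by case: (second_wins k); case: [exists x : 'I_n, (k < x) && second_wins x].
Qed.

Lemma den_main_outcome s :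
  [/\ s.1 0 = n, s.1 1 = size es, s.1 2 = n.+1, s.1 3 = 1 & s.1 4 = 2] ->
  (den main s).1 5 = outcome_code (game_outcome e).
Proof.
move=> Hs; rewrite den_main // /game_outcome.
have n0 : 0 < n by case: tree => _; rewrite card_ord.
have second : dom_wins_game e false = second_wins n.
  by rewrite /second_wins position_n setC0 cardsT.
have first : dom_wins_game e true = [exists x : 'I_n, second_wins x].
  rewrite /dom_wins_game card_ord [X in dom_wins _ X](_ : n = n.-1.+1) /= ?prednK //.
  apply: eq_existsb => x; rewrite !inE /second_wins position_ord cardsC1 card_ord.
  by rewrite setU0.
rewrite first second; case: ifP => [wn|_]; last by case: ifP.
(* If Dominator wins as second player, any first move wins too; vertex 0 is taken. *)
suff -> : [exists x : 'I_n, second_wins x] by [].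
apply/existsP; exists (Ordinal n0); rewrite /second_wins position_ord cardsC1.
apply: dom_wins_second_first => //; move: wn.
by rewrite /second_wins position_n setC0 cardsT.
Qed.

End Correctness.

Theorem theorem8 :
  exists (P : seq instr) (c k : nat),
    forall (n : nat) (es : seq (nat * nat)),
      valid_edges n es -> is_tree (graph_of n es) ->
      exists m : ram_mem,
        run (c * (n + size es + 1) ^ k) P (0, init_mem n es) = Some m /\
        m 0 = outcome_code (game_outcome (graph_of n es)).
Proof.
have [C [k Hcost]] := cost_poly main.
exists (program main), (C + 77), k => n es valid tree.
have n0 : 0 < n by case: tree => _; rewrite card_ord.
have N0 : 0 < n + size es + 1 by rewrite addn1.
(* The power is at least 1, so the constant overhead fits into the factor [C + 77]. *)
have fuel : cost (n + size es + 1) main + 77 <= (C + 77) * (n + size es + 1) ^ k.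
  rewrite mulnDl leq_add ?Hcost // -[X in X <= _]muln1 leq_mul2l.
  by rewrite expn_gt0 N0.
have [s [Hs [m Hrun Hm]]] := program_run n0 wf_main fuel.
by exists m; rewrite Hm (den_main_outcome valid tree Hs).
Qed.
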